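(* Let $G$ be a graph and let $H$ be its $1$-subdivision. The following statements are equivalent: (1) $H$ is a circle graph; (2) $H$ is an outer-segment graph; (3) $H$ is an outer-string graph; (4) $G$ is outerplanar.
   Context: Graphs are finite and simple. For a nonempty family $\mathcal{F}$ of subsets of $\mathbb{R}^2$, the intersection graph $\mathrm{Int}(\mathcal{F})$ has vertex set $\mathcal{F}$, and two distinct members $A,B\in\mathcal{F}$ are adjacent if and only if $A\cap B\neq\emptyset$. A family $\mathcal{F}$ is an intersection model of a graph $G$ if $G$ is isomorphic to $\mathrm{Int}(\mathcal{F})$. - A circle graph is a graph with an intersection model consisting of chords in a circle. - An outer-segment graph is a graph that has an intersection model consisting of straight-line segments lying in a (common) disk such that each segment has an endpoint on the boundary of the disk (both endpoints are allowed to be on the boundary). - An outer-string graph is a graph that has an intersection model consisting of curves lying in a (common) disk such that each curve has an endpoint on the boundary of the disk (both endpoints are allowed to be on the boundary). - A graph is outerplanar if it has a crossing-free embedding in the plane such that all vertices are on the same face. - The $1$-subdivision of $G$ is the graph obtained from $G$ by replacing each edge of $G$ by a path of length $2$ (with a new middle vertex for each edge). *)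

(* Defs.v *)
From HB Require Import structures.
From mathcomp Require Import all_boot all_order all_algebra.
From mathcomp Require Import all_classical all_reals all_analysis.
Set Implicit Arguments.
Unset Strict Implicit.
Unset Printing Implicit Defensive.
Import Order.TTheory GRing.Theory Num.Theory.
Import numFieldNormedType.Exports.

Record sgraph := SGraph {
  svertex :> finType;
  adj : rel svertex;
  adj_sym : symmetric adj;
  adj_irrefl : irreflexive adj }.

Definition is_edge (G : sgraph) (e : {set G}) : bool :=
  [exists u : G, exists v : G, adj u v && (e == [set u; v]%SET)].

Definition edge (G : sgraph) := {e : {set G} | is_edge e}.

Definition sub1_adj (G : sgraph) : rel (G + edge G)%type :=
  fun x y => match x, y with
             | inl v, inr e | inr e, inl v => v \in val e
             | _, _ => false
             end.

Lemma sub1_adj_sym (G : sgraph) : symmetric (@sub1_adj G).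
Proof. by case=> [u|e] [v|f]. Qed.

Lemma sub1_adj_irrefl (G : sgraph) : irreflexive (@sub1_adj G).
Proof. by case. Qed.

Definition subdivision1 (G : sgraph) : sgraph :=
  SGraph (@sub1_adj_sym G) (@sub1_adj_irrefl G).

Local Open Scope classical_set_scope.
Local Open Scope ring_scope.

(* Adjacency in Int(F). *)
Definition int_adj (T : Type) (A B : set T) : Prop :=
  A <> B /\ A `&` B !=set0.

(* [phi] is an isomorphism from G to Int(F). As F is a set, distinct vertices
   are represented by distinct subsets. F is automatically finite, and
   automatically nonempty when G has a vertex; the null graph is allowed the
   empty model. *)
Definition intersection_model (T : Type) (G : sgraph) (F : set (set T)) : Prop :=
  exists phi : G -> set T,
    set_bij [set: G] F phi /\
    forall u v : G, adj u v <-> int_adj (phi u) (phi v).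

Section Plane.
Variable R : realType.
Implicit Types (a b c : R * R) (A : set (R * R)) (r : R).

Definition sqdist a b : R := (a.1 - b.1) ^+ 2 + (a.2 - b.2) ^+ 2.

Definition disk c r : set (R * R) := [set x | sqdist x c <= r ^+ 2].

Definition circle c r : set (R * R) := [set x | sqdist x c = r ^+ 2].

Definition segment a b : set (R * R) :=
  [set (1 - t) *: a + t *: b | t in `[0, 1]].

Definition is_chord c r A : Prop :=
  exists a b, [/\ a <> b, circle c r a, circle c r b & A = segment a b].

Definition is_outer_segment c r A : Prop :=
  exists a b, [/\ a <> b, circle c r a, A `<=` disk c r & A = segment a b].

(* A curve is a continuous image of [0, 1], possibly self-intersecting. *)
Definition is_outer_string c r A : Prop :=
  exists f : R -> R * R,
    [/\ {within `[0, 1], continuous f}, circle c r (f 0), A `<=` disk c r &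
        A = f @` `[0, 1]].

Definition circle_graph (G : sgraph) : Prop :=
  exists c r, 0 < r /\
  exists F, F `<=` is_chord c r /\ intersection_model G F.

Definition outer_segment_graph (G : sgraph) : Prop :=
  exists c r, 0 < r /\
  exists F, F `<=` is_outer_segment c r /\ intersection_model G F.

Definition outer_string_graph (G : sgraph) : Prop :=
  exists c r, 0 < r /\
  exists F, F `<=` is_outer_string c r /\ intersection_model G F.

Definition is_arc a b A : Prop :=
  exists f : R -> R * R,
    [/\ {within `[0, 1], continuous f}, set_inj `[0, 1] f,
        f 0 = a, f 1 = b & A = f @` `[0, 1]].

Definition plane_embedding (G : sgraph) (p : G -> R * R)
    (gamma : edge G -> set (R * R)) : Prop :=
  [/\ injective p,
      forall (e : edge G) (u v : G), u != v -> u \in val e -> v \in val e ->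
        is_arc (p u) (p v) (gamma e),
      forall (e : edge G) (w : G), gamma e (p w) -> w \in val e &
      forall (e e' : edge G), e != e' ->
        gamma e `&` gamma e' `<=` [set p w | w in [set: G]]].

Definition drawing (G : sgraph) (p : G -> R * R)
    (gamma : edge G -> set (R * R)) : set (R * R) :=
  [set p w | w in [set: G]] `|` \bigcup_(e in [set: edge G]) gamma e.

(* A face of a drawing D is a connected component of its complement. *)
Definition is_face (D A : set (R * R)) : Prop :=
  exists2 x, (~` D) x & A = connected_component (~` D) x.

(* A vertex is on a face if it is on its boundary; as vertices belong to the
   drawing, hence not to the face, the closure suffices. *)
Definition outerplanar (G : sgraph) : Prop :=
  exists (p : G -> R * R) (gamma : edge G -> set (R * R)),
    plane_embedding p gamma /\
    exists A, is_face (drawing p gamma) A /\ forall v : G, closure A (p v).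

End Plane.

(* Main.v *)
Require Import Defs.
From mathcomp Require Import all_boot all_order all_algebra.
From mathcomp Require Import all_classical all_reals all_analysis.
From mathcomp Require Import ring lra zify.

(** All four conditions amount to a combinatorial one, [one_page]: the vertices
of G can be numbered so that no two edges ac and bd satisfy a < b < c < d.

From such a numbering to models. Put the vertices on a circle in this order;
the edges become chords that cross nowhere, and the exterior of the disk
touches every vertex, so G is outerplanar ([one_page_outerplanar]). To get a
chord model of H, thicken each vertex to a short chord and let the chords of
the edges at that vertex end inside the arc it cuts off, in the order that
keeps them disjoint ([one_page_circle_graph]).

From models to a numbering. An outerplanar drawing, and likewise an outer-string
model of H, yields a wheel-like configuration of continua: a hub O, pairwise
disjoint spokes running from points p v to the hub, and for each edge a
continuum C e that joins the points p of its two ends, avoids the hub and avoids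
the C f of all disjoint edges f. For a drawing the hub is a continuum in the
face that touches all vertices; for strings it is a larger concentric circle and
C e is the union of the strings of e and of its ends. The order in which the
spokes are met when walking around the hub is the required numbering
([spokes_one_page]): if ac and bd were interleaved, the closed curves through
the hub along ac and along bd would cross once, at the hub, whereas closed
curves in the plane cross an even number of times.

As curves may be arbitrarily wild, that last argument is carried out on a fine
square grid. The cells met by a continuum form a connected set of cells
([connected_hits]), and disjoint compact sets meet disjoint sets of cells once
the mesh is small ([compact_closed_gap]). In a graph with a cyclic order of
the darts at each vertex, crossings of two circulations x and y at a vertex are
measured by the alternating form that sums x_i y_j - x_j y_i over i < j
([crossing]); a transversal crossing contributes 2 or -2. On the grid the total
over all vertices vanishes, because a circulation is the boundary of a potential
on the faces ([grid_planar]). Contracting an edge does not change the total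
([crossing_splice]); contracting a spanning tree of the cells of the hub
therefore turns the hub into a single vertex with one cyclic sequence of
outgoing darts, at which two interleaved closed walks contribute 2
([interlaced_connections_meet]). *)

Set Implicit Arguments.
Unset Strict Implicit.
Unset Printing Implicit Defensive.
Import Order.TTheory GRing.Theory Num.Theory.
Import numFieldNormedType.Exports.
Local Open Scope classical_set_scope.
Local Open Scope ring_scope.

(** * Crossing numbers in rotation systems *)

Section CrossingForm.
Variables (D : eqType) (x y : D -> int).

Definition total (f : D -> int) (l : seq D) : int := \sum_(d <- l) f d.

(** For circulations x and y the value depends only on the cyclic order of l
([crossing_rot]). It is twice the signed number of crossings: if x enters by d1
and leaves by d3 while y enters by d2 and leaves by d4, with d1, d2, d3, d4 in
this order, the form is 2. *)
Fixpoint crossing (l : seq D) : int :=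
  if l is d :: l' then x d * total y l' - y d * total x l' + crossing l' else 0.

Lemma total_cat f l1 l2 : total f (l1 ++ l2) = total f l1 + total f l2.
Proof. by rewrite /total big_cat. Qed.

Lemma total_cons f d l : total f (d :: l) = f d + total f l.
Proof. by rewrite /total big_cons. Qed.

(** Cross terms between the two halves depend only on their totals; this is why
all the surgery on dart sequences below reduces to arithmetic on totals. *)
Lemma crossing_cat l1 l2 :
  crossing (l1 ++ l2) =
    crossing l1 + crossing l2 + total x l1 * total y l2 - total y l1 * total x l2.
Proof.
elim: l1 => [|d l IH] /=; first by rewrite /total !big_nil; ring.
by rewrite IH !total_cons !total_cat; ring.
Qed.

Lemma crossing_rot l1 l2 :
  total x (l1 ++ l2) = 0 -> total y (l1 ++ l2) = 0 ->
  crossing (l1 ++ l2) = crossing (l2 ++ l1).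
Proof.
rewrite !total_cat => hx hy; rewrite !crossing_cat.
have -> : total x l1 = - total x l2 by apply/eqP; rewrite -addr_eq0 hx.
have -> : total y l1 = - total y l2 by apply/eqP; rewrite -addr_eq0 hy.
ring.
Qed.

(** Invariance under contraction of an edge. Let d be the dart of the edge at one
end and e the opposite dart at the other end. Contracting replaces d by the
darts around the other end, read cyclically from e. These have the same total as
d for both x and y, by conservation at that end, so the surrounding cross terms
do not change, and the cross terms of e itself cancel. *)
Lemma crossing_splice l1 d l2 e r1 r2 :
    x e = - x d -> y e = - y d ->
    total x (r1 ++ e :: r2) = 0 -> total y (r1 ++ e :: r2) = 0 ->
  crossing (l1 ++ (r2 ++ r1) ++ l2) = crossing (l1 ++ d :: l2) + crossing (r1 ++ e :: r2).
Proof.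
move=> xe ye hx hy; rewrite (crossing_rot hx hy) /=.
move: hx hy; rewrite !total_cat !total_cons xe ye => hx hy.
have ex : x d = total x r1 + total x r2.
  by apply/eqP; rewrite -subr_eq0 -oppr_eq0; apply/eqP; rewrite -hx; ring.
have ey : y d = total y r1 + total y r2.
  by apply/eqP; rewrite -subr_eq0 -oppr_eq0; apply/eqP; rewrite -hy; ring.
rewrite !crossing_cat /= !total_cat ?total_cons ?xe ?ye ex ey. ring.
Qed.

Lemma total_eq0 f l : (forall d, d \in l -> f d = 0) -> total f l = 0.
Proof. by move=> h; apply: big1_seq => d /andP[_ /h]. Qed.

Lemma crossing_eq0l l : (forall d, d \in l -> x d = 0) -> crossing l = 0.
Proof.
elim: l => //= d l IH h.
have hl e : e \in l -> x e = 0 by move=> el; apply: h; rewrite inE el orbT.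
by rewrite IH // h ?mem_head // (total_eq0 hl); ring.
Qed.

Lemma crossing_eq0r l : (forall d, d \in l -> y d = 0) -> crossing l = 0.
Proof.
elim: l => //= d l IH h.
have hl e : e \in l -> y e = 0 by move=> el; apply: h; rewrite inE el orbT.
by rewrite IH // h ?mem_head // (total_eq0 hl); ring.
Qed.

End CrossingForm.

(** A rotation system: darts with an opposite-dart involution [rev], and for
each vertex the sequence [rot v] of its outgoing darts, read cyclically. A dart
may be left out of every rotation; [valid] selects the ones that take part. *)
Section Rotation.
Variables (V D : finType) (src : D -> V) (rev : D -> D) (rot : V -> seq D).
Hypothesis revK : involutive rev.
Hypothesis rot_uniq : forall v, uniq (rot v).
Hypothesis rot_src : forall v d, d \in rot v -> src d = v.

Let tgt d := src (rev d).
Definition valid d := d \in rot (src d).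
Hypothesis valid_rev : forall d, valid d -> valid (rev d).

Definition circulation (x : D -> int) :=
  [/\ forall d, x (rev d) = - x d, forall d, ~~ valid d -> x d = 0
    & forall v, total x (rot v) = 0].

Definition planar := forall x y, circulation x -> circulation y ->
  \sum_v crossing x y (rot v) = 0.

(** [thick_tree T L E]: a tree with vertex sequence T and darts E (both
orientations of each edge) is grown edge by edge, and L is the rotation of the
vertex obtained by contracting it, that is, the outgoing darts met while walking
around a thin neighbourhood of the tree. Darts between vertices of T that are
not tree edges stay in L, as loops of the contracted vertex. *)
Inductive thick_tree : seq V -> seq D -> seq D -> Prop :=
| TreeRoot v : thick_tree [:: v] (rot v) [::]
| TreeGrow T l1 d l2 E r1 r2 :
    thick_tree T (l1 ++ d :: l2) E -> tgt d \notin T ->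
    rot (tgt d) = r1 ++ rev d :: r2 ->
    thick_tree (tgt d :: T) (l1 ++ (r2 ++ r1) ++ l2) [:: d, rev d & E].

Lemma tree_crossing T L E x y : thick_tree T L E -> circulation x -> circulation y ->
  crossing x y L = \sum_(v <- T) crossing x y (rot v).
Proof.
move=> tT [xa _ xd] [ya _ yd]; elim: tT => [v|{}T l1 d l2 {}E r1 r2 _ IH _ rd].
  by rewrite big_seq1.
rewrite big_cons rd -IH addrC.
by apply: crossing_splice; rewrite -?rd ?xd ?yd ?xa ?ya.
Qed.

Lemma tree_uniq T L E : thick_tree T L E -> uniq T.
Proof. by elim=> // {}T l1 d l2 {}E r1 r2 _ uT dT _; rewrite /= dT. Qed.

Lemma tree_dart_ends T L E d : thick_tree T L E -> d \in E ->
  (src d \in T) && (tgt d \in T).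
Proof.
move=> tT; suff [] : {subset map src L <= T} /\
    (d \in E -> (src d \in T) && (tgt d \in T)) by [].
elim: tT => [v|{}T l1 e l2 {}E r1 r2 _ [IHL IHE] _ re].
  by split=> // w /mapP[a /rot_src -> ->]; rewrite inE.
have eT : src e \in T by apply: IHL; rewrite map_cat mem_cat inE eqxx orbT.
split.
  move=> w /mapP[a + ->]; rewrite !mem_cat => /or3P[al|/orP ar|al].
  - by rewrite inE IHL ?orbT // map_f // mem_cat al.
  - rewrite inE (_ : src a = tgt e) ?eqxx //; apply: rot_src.
    by rewrite re mem_cat inE; case: ar => ->; rewrite ?orbT.
  - by rewrite inE IHL ?orbT // map_f // mem_cat inE al !orbT.
rewrite !inE /tgt => /or3P[/eqP->|/eqP->|/IHE/andP[-> ->]].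
- by rewrite eT eqxx orbT.
- by rewrite revK eT eqxx orbT.
- by rewrite !orbT.
Qed.

(** Growing the tree moves the new edge from L to E and brings the other darts of
the new vertex into L, where none of them was before. *)
Lemma tree_boundary T L E : thick_tree T L E ->
  [/\ uniq L, forall d, d \in L -> [&& valid d, src d \in T & d \notin E] &
      forall d, valid d -> src d \in T -> d \in L ++ E].
Proof.
move=> tT; elim: tT (tT) => [v _|{}T l1 e l2 {}E r1 r2 tT IH eT re _].
  split=> // d; last by rewrite /valid inE cats0 => vd /eqP<-.
  by move=> dv; rewrite /valid (rot_src dv) dv inE eqxx.
have [uL LT TL] := IH tT.
move: uL; rewrite (uniq_catCA l1 [:: e]) cons_uniq => /andP[eL uL].
have := rot_uniq (tgt e); rewrite re (uniq_catCA r1 [:: rev e]) cons_uniq.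
rewrite uniq_catC => /andP[eR uR].
have rT' a : a \in r2 ++ r1 -> a \in rot (tgt e).
  by rewrite re !mem_cat inE => /orP[]->; rewrite ?orbT.
have rT a : a \in r2 ++ r1 -> src a = tgt e by move/rT'/rot_src.
have LT' a : a \in l1 ++ l2 -> [&& valid a, src a \in T & a \notin E].
  rewrite mem_cat => al; apply: LT; rewrite mem_cat inE.
  by case/orP: al => ->; rewrite ?orbT.
have eT' : src e \in T.
  have /LT/and3P[] // : e \in l1 ++ e :: l2 by rewrite mem_cat inE eqxx orbT.
have memL a : (a \in l1 ++ (r2 ++ r1) ++ l2) = (a \in r2 ++ r1) || (a \in l1 ++ l2).
  by rewrite !mem_cat; do ![case: (_ \in _)].
split.
- rewrite uniq_catCA cat_uniq uR uL andbT /=.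
  apply/hasPn => a /LT' /and3P[_ aT _]; apply: contra eT.
  by move/rT => <-.
- move=> a; rewrite memL => /orP[ar|al].
    rewrite /valid inE (rT _ ar) rT' // eqxx /= !inE !negb_or; apply/and3P; split.
    + by apply: contraNneq eT => ae; rewrite -(rT _ ar) ae.
    + apply: contraNneq eR => <-; move: ar; rewrite !mem_cat.
      by rewrite orbC.
    + apply: contra eT => /(tree_dart_ends tT)/andP[aT _].
      by rewrite -(rT _ ar).
  have /and3P[va aT aE] := LT' _ al.
  rewrite inE va aT orbT /= !inE !negb_or aE andbT; apply/andP; split.
    by apply: contraNneq eL => <-.
  by apply: contraNneq eT => ae; rewrite /tgt -ae.
- move=> a va; rewrite inE [a \in _ ++ _ :: _]mem_cat memL !inE => /orP[/eqP sa|sa].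
    move: va; rewrite /valid sa re !mem_cat !inE.
    by case/or3P => ->; rewrite ?orbT.
  have := TL a va sa; rewrite !mem_cat !inE.
  by case/orP=> [/or3P[]|] ->; rewrite ?orbT.
Qed.

Definition step u v := [exists d, [&& valid d, src d == u & tgt d == v]].

Definition within (S : pred V) := [rel u v | [&& step u v, S u & S v]].

Lemma step_sym : symmetric step.
Proof.
suff st u v : step u v -> step v u by move=> u v; apply/idP/idP; exact: st.
case/existsP=> d /and3P[vd /eqP<- /eqP<-]; apply/existsP; exists (rev d).
by rewrite valid_rev // /tgt revK !eqxx.
Qed.

Lemma connect_within_sym S : connect_sym (within S).
Proof. by apply: sym_connect_sym => u v /=; rewrite step_sym [S u && _]andbC. Qed.

Lemma connect_withinS (S S' : pred V) u v : {subset S <= S'} ->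
  connect (within S) u v -> connect (within S') u v.
Proof.
move=> SS'; apply: connect_sub => a b /and3P[ab /SS' Sa /SS' Sb].
by apply: connect1; rewrite /= ab [S' a]Sa [S' b]Sb.
Qed.

(** A tree that does not yet fill S can be grown, because a path in S from the
root to a missing vertex has a first dart that leaves the tree. *)
Lemma tree_exists (S : pred V) v0 : S v0 ->
    (forall u, S u -> connect (within S) v0 u) ->
  exists T L E, thick_tree T L E /\ T =i S.
Proof.
move=> S0 Sc.
have grow k : (k <= #|S|)%N -> exists T L E, [/\ thick_tree T L E, v0 \in T,
    {subset T <= S} & (k <= size T)%N].
  elim: k => [_|k IH kS].
    exists [:: v0], (rot v0), [::]; split=> //; first exact: TreeRoot.
      by rewrite inE eqxx.
    by move=> u; rewrite inE => /eqP ->.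
  have [T [L [E [tT T0 TS kT]]]] := IH (ltnW kS).
  have [|Tk] := ltnP k (size T); first by exists T, L, E.
  have [u Su uT] : exists2 u, u \in S & u \notin T.
    apply/subsetPn; apply: contraTN kS => /subset_leq_card ST.
    rewrite -leqNgt (leq_trans ST) // (leq_trans _ Tk) //.
    exact: card_size.
  have [d [vd sd td Sd]] : exists d, [/\ valid d, src d \in T, tgt d \notin T & S (tgt d)].
    have /connectP[p pp eu] := Sc u Su.
    move: (v0) T0 pp eu; elim: p => [|w p IHp] v1 v1T /=.
      by move=> _ eu; rewrite eu v1T in uT.
    case/andP=> /and3P[/existsP[d /and3P[vd /eqP sd /eqP td]] _ Sw] pp eu.
    have [wT|wT] := boolP (w \in T); first exact: (IHp w).
    by exists d; rewrite vd sd td.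
  have [_ _ /(_ d vd sd)] := tree_boundary tT.
  rewrite mem_cat => /orP[dL|/(tree_dart_ends tT)/andP[_]]; last by rewrite (negbTE td).
  case/splitPr: L / dL tT => l1 l2 tT.
  have [r1 [r2 rE]] : exists r1 r2, rot (tgt d) = r1 ++ rev d :: r2.
    have := valid_rev vd; rewrite /valid -/(tgt d) => dr.
    by case/splitPr: dr => r1 r2; exists r1, r2.
  exists (tgt d :: T), (l1 ++ (r2 ++ r1) ++ l2), [:: d, rev d & E]; split=> //.
  - exact: TreeGrow.
  - by rewrite inE T0 orbT.
  - by move=> a; rewrite inE => /orP[/eqP->|/TS//].
have [T [L [E [tT T0 TS kT]]]] := grow _ (leqnn #|S|).
exists T, L, E; split=> //.
have TS' : {subset T <= enum S} by move=> a /TS; rewrite mem_enum.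
have [] := uniq_min_size (tree_uniq tT) TS'; first by rewrite -cardE.
by move=> _ TE a; rewrite TE mem_enum.
Qed.

Fixpoint walk u W v :=
  if W is d :: W' then [&& valid d, src d == u & walk (tgt d) W' v] else u == v.

Lemma walk_cat u W1 v W2 w : walk u W1 v -> walk v W2 w -> walk u (W1 ++ W2) w.
Proof.
elim: W1 u => [|d W1 IH] u /=; first by move/eqP->.
by case/and3P=> -> -> /IH h /h.
Qed.

Lemma walk_valid u W v d : walk u W v -> d \in W -> valid d.
Proof.
elim: W u => //= e W IH u /and3P[ve _ /IH We].
by rewrite inE => /orP[/eqP->|/We].
Qed.

Definition flow (W : seq D) (d : D) : int :=
  (count_mem d W)%:Z - (count_mem (rev d) W)%:Z.

Lemma sum_indicator (l : seq D) d : uniq l -> \sum_(e <- l) (d == e)%:Z = (d \in l)%:Z.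
Proof.
elim: l => [|e l IH] /=; first by rewrite big_nil.
case/andP=> el ul; rewrite big_cons inE IH //.
by have [->|_] := eqVneq d e; rewrite ?(negbTE el).
Qed.

Lemma valid_mem d v : valid d -> (d \in rot v) = (src d == v).
Proof. by move=> vd; apply/idP/eqP => [/rot_src//|<-]. Qed.

(** Each dart of the walk adds 1 at its source and -1 at its target, so the sum
telescopes. *)
Lemma walk_divergence u W w v : walk u W w ->
  total (flow W) (rot v) = (u == v)%:Z - (w == v)%:Z.
Proof.
elim: W u => [|d W IH] u /=.
  by move/eqP->; rewrite subrr; apply: total_eq0 => d _; rewrite /flow subrr.
case/and3P=> vd /eqP <- /IH; rewrite /total => Wd.
transitivity (\sum_(e <- rot v) ((d == e)%:Z - (rev d == e)%:Z + flow W e)).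
  apply: eq_bigr => e _; rewrite /flow /= !PoszD.
  have -> : (d == rev e) = (rev d == e).
    by rewrite -(inj_eq (inv_inj revK)) revK.
  ring.
rewrite big_split /= sumrB !sum_indicator // Wd !valid_mem ?valid_rev //.
rewrite -/(tgt d); ring.
Qed.

Lemma flow_circulation u W : walk u W u -> circulation (flow W).
Proof.
move=> Wu; split=> [d|d nd|v]; last by rewrite (walk_divergence _ Wu) subrr.
  by rewrite /flow revK opprB.
rewrite /flow !(count_memPn _) //.
  by apply: contra nd => /(walk_valid Wu)/valid_rev; rewrite revK.
by apply: contra nd => /(walk_valid Wu).
Qed.

Lemma connect_walk (S : pred V) u v :
  connect (within S) u v ->
  exists2 W, walk u W v & forall d, d \in W -> S (src d) && S (tgt d).
Proof.
move=> /connectP[p pp ->]; elim: p u pp => [|w p IH] u /=.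
  by exists [::] => /=.
case/andP=> /and3P[/existsP[d /and3P[vd sd /eqP td]] Su Sw] /IH[W Ww WS].
exists (d :: W); first by rewrite /= vd sd td.
move=> e; rewrite inE => /orP[/eqP->|/WS//].
by rewrite td Sw (eqP sd) Su.
Qed.

Lemma tree_rev T L E d : thick_tree T L E -> d \in E -> rev d \in E.
Proof.
move=> tT; elim: tT => [//|{}T l1 e l2 {}E r1 r2 _ IH _ _].
rewrite !inE (inj_eq (inv_inj revK)) => /or3P[/eqP->|/eqP->|/IH->].
- by rewrite eqxx orbT.
- by rewrite revK eqxx.
- by rewrite !orbT.
Qed.

Lemma tree_walk T L E u v : thick_tree T L E -> u \in T -> v \in T ->
  exists2 W, walk u W v & {subset W <= E}.
Proof.
move=> tT; elim: tT u v => [r|{}T l1 e l2 {}E r1 r2 tT IH eT _] u v.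
  by rewrite !inE => /eqP-> /eqP->; exists [::] => /=.
have [_ /(_ e) + _] := tree_boundary tT.
rewrite mem_cat inE eqxx orbT => /(_ isT)/and3P[ve se _].
have sub (W : seq D) : {subset W <= E} -> {subset W <= [:: e, rev e & E]}.
  by move=> WE d /WE; rewrite !inE => ->; rewrite !orbT.
rewrite !inE => /orP[/eqP->|uT] /orP[/eqP->|vT].
- by exists [::] => /=.
- have [W We WE] := IH _ _ se vT; exists (rev e :: W).
    by rewrite /= valid_rev // /tgt revK eqxx.
  by move=> d; rewrite inE => /orP[/eqP->|/(sub _ WE)//]; rewrite !inE eqxx orbT.
- have [W We WE] := IH _ _ uT se; exists (W ++ [:: e]).
    by apply: walk_cat We _; rewrite /= ve !eqxx.
  by move=> d; rewrite mem_cat => /orP[/(sub _ WE)//|]; rewrite !inE => ->.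
- by have [W We WE] := IH _ _ uT vT; exists W => //; apply: sub.
Qed.

(** Closing up a connection outside the tree: leave by s, follow the connection
inside X, return by t, and go back to the source of s along tree edges. Tree
edges do not occur in L, so around the contracted tree the only trace of this
closed walk is s, outgoing, and t, incoming. *)
Lemma excursion T L E (X : pred V) s t : thick_tree T L E ->
    s \in L -> t \in L -> X (tgt s) -> X (tgt t) ->
    (forall v, X v -> v \notin T) ->
    connect (within X) (tgt s) (tgt t) ->
  exists2 x, circulation x &
    (forall d, d \in L -> x d = (d == s)%:Z - (d == t)%:Z) /\
    (forall d, src d \notin T -> ~~ X (src d) -> x d = 0).
Proof.
move=> tT sL tL Xs Xt XT /connect_walk[W Wst WX].
have [_ LT _] := tree_boundary tT.
have /and3P[vs sT sE] := LT s sL; have /and3P[vt tT' tE] := LT t tL.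
have [Z Zts ZE] := tree_walk tT tT' sT.
pose C := s :: W ++ rev t :: Z.
have Cs : walk (src s) C (src s).
  rewrite /= vs eqxx; apply: walk_cat Wst _ => /=.
  by rewrite valid_rev // /tgt eqxx revK.
exists (flow C); first exact: flow_circulation Cs.
have ZT d : d \in Z -> (src d \in T) && (tgt d \in T) by move/ZE/(tree_dart_ends tT).
have W0 d : (src d \in T) || ~~ X (src d) ->
    (count_mem d W = 0)%N /\ (count_mem (rev d) W = 0)%N.
  move=> dX; split; apply/count_memPn; apply/negP => /WX/andP[].
    by move=> Xd; rewrite Xd orbF in dX; move: (XT _ Xd); rewrite dX.
  rewrite /tgt revK => _ Xd; rewrite Xd orbF in dX.
  by move: (XT _ Xd); rewrite dX.
split=> d.
  move=> /LT/and3P[vd dT dE].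
  have [W1 W2] := W0 d (introT orP (or_introl dT)).
  rewrite /flow /C /= !count_cat W1 W2 /=.
  have Z1 : (count_mem d Z = 0)%N by apply/count_memPn; apply: contra dE => /ZE.
  have Z2 : (count_mem (rev d) Z = 0)%N.
    by apply/count_memPn; apply: contra dE => /ZE/(tree_rev tT); rewrite revK.
  rewrite Z1 Z2 (inj_eq (inv_inj revK)).
  have -> : (rev t == d) = false.
    by apply: contraTF dT => /eqP <-; rewrite XT.
  have -> : (s == rev d) = false.
    by apply: contraTF dT => /eqP sd; rewrite XT // -[d]revK -sd.
  by rewrite !add0n !addn0 (eq_sym s) (eq_sym t).
move=> dT nX; have [W1 W2] := W0 d (introT orP (or_intror nX)).
rewrite /flow /C /= !count_cat W1 W2 /=.
have Z1 : (count_mem d Z = 0)%N.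
  by apply/count_memPn; apply: contra dT => /ZT/andP[].
have Z2 : (count_mem (rev d) Z = 0)%N.
  by apply/count_memPn; apply: contra dT => /ZT/andP[_]; rewrite /tgt revK.
rewrite Z1 Z2 (inj_eq (inv_inj revK)).
have -> : (s == d) = false by apply: contraNF dT => /eqP <-.
have -> : (t == d) = false by apply: contraNF dT => /eqP <-.
have -> : (rev t == d) = false by apply: contraNF nX => /eqP <-.
have -> : (s == rev d) = false.
  by apply: contraNF nX => /eqP sd; rewrite -[d]revK -sd.
by [].
Qed.

Lemma crossing_interlaced (x y : D -> int) a b c d l0 l1 l2 l3 l4 :
    let L := l0 ++ a :: l1 ++ b :: l2 ++ c :: l3 ++ d :: l4 in uniq L ->
    (forall e, e \in L -> x e = (e == a)%:Z - (e == c)%:Z) ->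
    (forall e, e \in L -> y e = (e == b)%:Z - (e == d)%:Z) ->
  crossing x y L = 2.
Proof.
move=> L uL xL yL.
have pL : perm_eq L ([:: a; b; c; d] ++ (l0 ++ l1 ++ l2 ++ l3 ++ l4)).
  by apply/permP => p; rewrite /L; do 6!rewrite ?count_cat /=; lia.
move: uL; rewrite (perm_uniq pL) cat_uniq => /and3P[].
rewrite /= !inE !negb_or -!andbA => /and5P[ab ac ad bc /and3P[bd cd _]] /hasPn out _.
have xy e : e \in l0 ++ l1 ++ l2 ++ l3 ++ l4 -> x e = 0 /\ y e = 0.
  move=> el; have := out e el; rewrite !inE !negb_or => /and4P[ea eb ec ed].
  have eL : e \in L by rewrite (perm_mem pL) mem_cat el orbT.
  rewrite xL ?yL //.
  by rewrite (negbTE ea) (negbTE eb) (negbTE ec) (negbTE ed).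
have abcd e : e \in [:: a; b; c; d] -> e \in L.
  by move=> el; rewrite (perm_mem pL) mem_cat el.
have [aL bL cL dL] : [/\ a \in L, b \in L, c \in L & d \in L].
  by split; apply: abcd; rewrite !inE eqxx ?orbT.
have xa : x a = 1 by rewrite xL // eqxx (negbTE ac).
have xb : x b = 0 by rewrite xL // eq_sym (negbTE ab) (negbTE bc).
have xc : x c = -1 by rewrite xL // eqxx eq_sym (negbTE ac).
have xd : x d = 0 by rewrite xL // ![d == _]eq_sym (negbTE ad) (negbTE cd).
have ya : y a = 0 by rewrite yL // (negbTE ab) (negbTE ad).
have yb : y b = 1 by rewrite yL // eqxx (negbTE bd).
have yc : y c = 0 by rewrite yL // eq_sym (negbTE bc) (negbTE cd).
have yd : y d = -1 by rewrite yL // eqxx eq_sym (negbTE bd).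
have zero l : {subset l <= l0 ++ l1 ++ l2 ++ l3 ++ l4} ->
    [/\ total x l = 0, total y l = 0 & crossing x y l = 0].
  by move=> lz; split; [apply: total_eq0|apply: total_eq0|apply: crossing_eq0l] => e /lz /xy [].
have [| x0 y0 f0] := zero l0; first by move=> e; rewrite !mem_cat => ->.
have [| x1 y1 f1] := zero l1; first by move=> e; rewrite !mem_cat => ->; rewrite ?orbT.
have [| x2 y2 f2] := zero l2; first by move=> e; rewrite !mem_cat => ->; rewrite ?orbT.
have [| x3 y3 f3] := zero l3; first by move=> e; rewrite !mem_cat => ->; rewrite ?orbT.
have [| x4 y4 f4] := zero l4; first by move=> e; rewrite !mem_cat => ->; rewrite ?orbT.
rewrite /L !(crossing_cat, total_cat, total_cons) /= !(crossing_cat, total_cat, total_cons) /=.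
rewrite !(crossing_cat, total_cat, total_cons) /= !(crossing_cat, total_cat, total_cons) /=.
rewrite x0 x1 x2 x3 x4 y0 y1 y2 y3 y4 f0 f1 f2 f3 f4 xa xb xc xd ya yb yc yd.
by [].
Qed.

Lemma split_before (L : seq D) f : f \in L ->
  exists l0 l1, L = l0 ++ f :: l1 /\
    forall e, (index e L < index f L)%N -> e \in l0 /\ index e L = index e l0.
Proof.
move=> fL; exists (take (index f L) L), (drop (index f L).+1 L).
have eL : L = take (index f L) L ++ f :: drop (index f L).+1 L.
  by rewrite -{2}(nth_index f fL) -drop_nth ?index_mem // cat_take_drop.
split=> // e ef.
have : index e L = index e (take (index f L) L ++ f :: drop (index f L).+1 L).
  by rewrite -eL.
rewrite index_cat size_take index_mem fL; case: ifP => // _ ei.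
by move: ef; rewrite ei ltnNge leq_addr.
Qed.

Lemma split_before4 (L : seq D) a b c d :
    (index a L < index b L)%N -> (index b L < index c L)%N ->
    (index c L < index d L)%N -> d \in L ->
  exists l0 l1 l2 l3 l4, L = l0 ++ a :: l1 ++ b :: l2 ++ c :: l3 ++ d :: l4.
Proof.
move=> ab bc cd /split_before[p [l4 [eL dP]]].
have [cp ec] := dP c cd; have [_ eb] := dP b (ltn_trans bc cd).
have [_ ea] := dP a (ltn_trans ab (ltn_trans bc cd)).
rewrite ea eb in ab; rewrite eb ec in bc.
have [q [l3 [eq cQ]]] := split_before cp; have [bq eb'] := cQ b bc.
have [_ ea'] := cQ a (ltn_trans ab bc); rewrite ea' eb' in ab.
have [l0 [l1 [eq' aQ]]] := split_before bq; have [al0 _] := aQ a ab.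
rewrite eL eq eq'; case/splitPr: al0 => l0' l1'.
by exists l0', l1', l1, l3, l4; do 4!rewrite -?catA /=.
Qed.

(** The two closed walks of [excursion] share no vertex outside T, so all their
crossings take place in T. There the total is that of the contracted tree, which
is 2 for interleaved ends, and planarity says that it is 0. *)
Theorem interlaced_connections_meet T L E (X Y : pred V) a b c d :
    planar -> thick_tree T L E ->
    (index a L < index b L)%N -> (index b L < index c L)%N ->
    (index c L < index d L)%N -> d \in L ->
    X (tgt a) -> X (tgt c) -> Y (tgt b) -> Y (tgt d) ->
    (forall v, X v -> v \notin T) -> (forall v, Y v -> v \notin T) ->
    (forall v, X v -> ~~ Y v) ->
    connect (within X) (tgt a) (tgt c) ->
    connect (within Y) (tgt b) (tgt d) -> False.
Proof.
move=> pl tT ab bc cd dL Xa Xc Yb Yd XT YT XY ac bd.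
have iL e f : (index e L < index f L)%N -> e \in L.
  by move=> ef; rewrite -index_mem (leq_trans ef) // index_size.
have aL := iL _ _ ab; have bL := iL _ _ bc; have cL := iL _ _ cd.
have [x cx [xL x0]] := excursion tT aL cL Xa Xc XT ac.
have [y cy [yL y0]] := excursion tT bL dL Yb Yd YT bd.
have [uL _ _] := tree_boundary tT.
have [l0 [l1 [l2 [l3 [l4 eL]]]]] := split_before4 ab bc cd dL.
have L2 : crossing x y L = 2 by move: uL xL yL; rewrite eL; apply: crossing_interlaced.
have := pl x y cx cy; rewrite (bigID (mem T)) /= [X in _ + X]big1 => [|v vT].
  by rewrite addr0 -big_uniq ?(tree_uniq tT) // -(tree_crossing tT cx cy) L2.
have [Xv|nXv] := boolP (X v).
  apply: crossing_eq0r => e ev; apply: y0; rewrite (rot_src ev) //.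
  exact: XY.
by apply: crossing_eq0l => e ev; apply: x0; rewrite (rot_src ev).
Qed.

End Rotation.

(** * Planarity of the square grid *)

Lemma crossing_filter (D : eqType) (x y : D -> int) (p : pred D) l :
  (forall d, ~~ p d -> x d = 0) -> (forall d, ~~ p d -> y d = 0) ->
  crossing x y [seq d <- l | p d] = crossing x y l.
Proof.
move=> xp yp.
have tf m (f : D -> int) : (forall d, ~~ p d -> f d = 0) ->
    total f [seq d <- m | p d] = total f m.
  move=> fp; rewrite /total big_filter [RHS](bigID p) /=.
  by rewrite [X in _ + X]big1 ?addr0.
elim: l => //= d l IH.
have [pd|pd] := boolP (p d); first by rewrite /= IH !tf.
by rewrite IH (xp d pd) (yp d pd); ring.
Qed.

(** The grid is wrapped into a torus so that shifts are bijections of ['I_N];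
darts that cross the seam are kept out of the rotations by [inside]. A dart is a
cell with a direction: the first boolean tells vertical from horizontal, the
second marks the negative sense. *)
Section Grid.
Variable N : nat.

Definition cell := ('I_N * 'I_N)%type.
Definition dart := (cell * (bool * bool))%type.

Definition shift (n : bool) (i : 'I_N) := if n then ord_pred i else ordS i.

Definition dsrc (d : dart) : cell := d.1.

Definition dtgt (d : dart) : cell :=
  let: ((i, j), (o, n)) := d in if o then (i, shift n j) else (shift n i, j).

Definition drev (d : dart) : dart := (dtgt d, (d.2.1, ~~ d.2.2)).

Definition inner (n : bool) (i : 'I_N) := if n then (0 < i)%N else (i.+1 < N)%N.

Definition inside (d : dart) : bool :=
  let: ((i, j), (o, n)) := d in if o then inner n j else inner n i.

(** East, north, west, south: the counterclockwise order. *)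
Definition rose (v : cell) : seq dart :=
  [:: (v, (false, false)); (v, (true, false));
      (v, (false, true)); (v, (true, true))].

Definition drot (v : cell) := [seq d <- rose v | inside d].

Lemma shiftK n i : shift (~~ n) (shift n i) = i.
Proof. by case: n; rewrite /shift /= ?ordSK ?ord_predK. Qed.

Lemma drevK : involutive drev.
Proof. by case=> [[i j] [[] n]]; rewrite /drev /= negbK shiftK. Qed.

Lemma inner_shift n i : inner n i -> inner (~~ n) (shift n i).
Proof.
case: n i => -[i iN] /=; rewrite /inner /=.
  by case: i iN => // i iN _; rewrite /= modnDr modn_small ?(ltnW iN).
by move=> h; rewrite modn_small.
Qed.

Lemma drot_uniq v : uniq (drot v).
Proof. by apply: filter_uniq; rewrite /= !inE !xpair_eqE /= !andbF. Qed.

Lemma drot_src v d : d \in drot v -> dsrc d = v.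
Proof. by rewrite mem_filter !inE => /andP[_] /or4P[] /eqP ->. Qed.

Lemma drot_valid d : valid dsrc drot d = inside d.
Proof.
rewrite /valid mem_filter; case: d => v [ax n] /=.
by rewrite !inE !xpair_eqE eqxx; case: ax n => -[]; rewrite /= ?orbT andbT.
Qed.

Lemma dvalid_rev d : valid dsrc drot d -> valid dsrc drot (drev d).
Proof.
rewrite !drot_valid; case: d => -[i j] [[] n] /=; exact: inner_shift.
Qed.

(** A circulation on the grid is the boundary of the function on faces which to
the face north-east of the vertex (i, j) assigns the total flow through the
horizontal edges at or below it. The boundary equations [eastE] and [northE]
hold on the torus without exceptions because no flow crosses the seam. *)
Section Potential.
Variable y : dart -> int.
Implicit Types i j : 'I_N.
Hypothesis cy : circulation dsrc drev drot y.

Let east v := y (v, (false, false)).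
Let north v := y (v, (true, false)).

Definition potential (i j : 'I_N) : int := \sum_(k < N | (k <= j)%N) east (i, k).

Lemma west_east i j : y ((i, j), (false, true)) = - east (ord_pred i, j).
Proof. by have [ya _ _] := cy; rewrite /east -ya /drev /= ord_predK. Qed.

Lemma south_north i j : y ((i, j), (true, true)) = - north (i, ord_pred j).
Proof. by have [ya _ _] := cy; rewrite /north -ya /drev /= ord_predK. Qed.

Lemma total_drot (f : dart -> int) v : (forall d, ~~ inside d -> f d = 0) ->
  total f (drot v) = total f (rose v).
Proof.
move=> f0; rewrite /total big_filter [RHS](bigID inside) /=.
by rewrite [X in _ + X]big1 ?addr0.
Qed.

Lemma y_outside d : ~~ inside d -> y d = 0.
Proof. by rewrite -drot_valid; have [_ + _] := cy; exact. Qed.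

Lemma divergence i j :
  east (i, j) + north (i, j) = east (ord_pred i, j) + north (i, ord_pred j).
Proof.
have [_ _ /(_ (i, j))] := cy; rewrite total_drot; last exact: y_outside.
rewrite /total /rose !big_cons big_nil west_east south_north => e.
by apply/eqP; rewrite -subr_eq0 -e; apply/eqP; rewrite /east /north; ring.
Qed.

Lemma ord_predE (i : 'I_N) : (0 < i)%N -> ord_pred i = i.-1 :> nat.
Proof.
by case: i => -[//|i] iN _ /=; rewrite modnDr modn_small // ltnW.
Qed.

Lemma ord_pred0 (i : 'I_N) : i = 0%N :> nat -> ord_pred i = N.-1 :> nat.
Proof. by move=> /= ->; rewrite add0n modn_small // prednK // (leq_ltn_trans _ (ltn_ord i)). Qed.

Lemma north_last (i j : 'I_N) : j = N.-1 :> nat -> north (i, j) = 0.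
Proof.
move=> jN; apply: y_outside; rewrite /= jN prednK ?ltnn //.
exact: leq_ltn_trans (ltn_ord j).
Qed.

Lemma east_last (i j : 'I_N) : i = N.-1 :> nat -> east (i, j) = 0.
Proof.
move=> iN; apply: y_outside; rewrite /= iN prednK ?ltnn //.
exact: leq_ltn_trans (ltn_ord i).
Qed.

Lemma potentialS (i j : 'I_N) : (0 < j)%N ->
  potential i j = potential i (ord_pred j) + east (i, j).
Proof.
move=> j0; rewrite /potential (bigD1 j) // addrC; congr (_ + _).
by apply: eq_bigl => k; rewrite ord_predE // -val_eqE; case: j j0 => j /=; lia.
Qed.

Lemma potential0 (i j : 'I_N) : j = 0%N :> nat -> potential i j = east (i, j).
Proof.
move=> j0; rewrite /potential (bigD1 j) //= big1 ?addr0 // => k /andP[].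
by rewrite j0 leqn0 => /eqP k0 /eqP[]; apply: val_inj; rewrite /= k0 j0.
Qed.

(** Conservation at (i, j) carries the equation from row j - 1 to row j; in row
0 the seam contributes nothing. *)
Lemma northE (i j : 'I_N) : north (i, j) = potential (ord_pred i) j - potential i j.
Proof.
have [k jk] : exists k, j = k :> nat by exists j.
elim: k j jk => [|k IH] j jk.
  rewrite !potential0 //; have := divergence i j.
  rewrite (@north_last i (ord_pred j)) ?ord_pred0 // addr0 => <-; ring.
have j0 : (0 < j)%N by rewrite jk.
rewrite (potentialS _ j0) [in RHS](potentialS i j0).
have IHj := IH (ord_pred j); rewrite ord_predE // jk in IHj.
have := divergence i j; rewrite IHj // => e.
have -> : north (i, j) = east (i, j) + north (i, j) - east (i, j) by ring.
by rewrite e; ring.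
Qed.

(** Above the top row the potential does not change from column to column, since
no vertical edge crosses the seam, and it vanishes in the last column, since no
horizontal edge does. *)
Lemma potential_last (i j : 'I_N) : j = N.-1 :> nat -> potential i j = 0.
Proof.
move=> jN; have pc i' : potential (ord_pred i') j = potential i' j.
  by apply/eqP; rewrite -subr_eq0 -northE north_last.
have [k ik] : exists k, i = k :> nat by exists i.
have p0 i' : i' = 0%N :> nat -> potential i' j = 0.
  move=> i0; rewrite -pc /potential big1 // => l _.
  by rewrite east_last // ord_pred0.
elim: k i ik => [|k IH] i ik; first exact: p0.
by rewrite -pc IH // ord_predE ?ik // ik.
Qed.

Lemma eastE (i j : 'I_N) : east (i, j) = potential i j - potential i (ord_pred j).
Proof.
have [j0|j0] := posnP j; last by rewrite potentialS //; ring.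
by rewrite potential0 // (@potential_last _ (ord_pred j)) ?ord_pred0 // subr0.
Qed.

End Potential.

(** With y written through its potential, the partial sums of y around the vertex
telescope, and the contribution of each dart of x becomes minus its flow times
the sum of the potentials on the two sides of its edge. Opposite darts have
opposite flows and the same two sides, which gives the form of a discrete
divergence. *)
Lemma crossing_rose x y i j :
    circulation dsrc drev drot x -> circulation dsrc drev drot y ->
    let P := potential y in
    let mE i j := x ((i, j), (false, false)) * (P i j + P i (ord_pred j)) in
    let mN i j := x ((i, j), (true, false)) * (P i j + P (ord_pred i) j) in
  crossing x y (drot (i, j)) =
    (mE (ord_pred i) j - mE i j) + (mN i (ord_pred j) - mN i j).
Proof.
move=> cx cy P mE mN.
have zx := y_outside cx; have zy := y_outside cy.
have -> : crossing x y (drot (i, j)) = crossing x y (rose (i, j)) by apply: crossing_filter.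
rewrite /= !total_cons /total !big_nil (west_east cx) (south_north cx).
rewrite (west_east cy) (south_north cy) !(eastE cy) !(northE cy).
have := divergence cx i j; rewrite /mE /mN -/P => e.
have -> : x ((i, j), (true, false)) = x ((ord_pred i, j), (false, false))
    + x ((i, ord_pred j), (true, false)) - x ((i, j), (false, false)).
  by rewrite -e; ring.
ring.
Qed.

Lemma grid_planar : planar dsrc drev drot.
Proof.
move=> x y cx cy.
have sh (f : 'I_N -> int) : \sum_i (f (ord_pred i) - f i) = 0.
  by rewrite sumrB [X in _ - X](reindex_inj (@ord_pred_inj N)) subrr.
transitivity (\sum_i \sum_j crossing x y (drot (i, j))).
  by rewrite pair_bigA; apply: eq_bigr => -[].
under eq_bigr => i _ do under eq_bigr => j _ do rewrite (crossing_rose i j cx cy).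
under eq_bigr => i _ do rewrite big_split /= sh addr0.
by rewrite exchange_big big1 // => j _; apply: sh.
Qed.

End Grid.

(** * From continua to sets of cells *)

Local Notation gstep N := (step (@dsrc N) (@drev N) (@drot N)).
Local Notation gwithin N := (within (@dsrc N) (@drev N) (@drot N)).

Lemma near_implies T (F : set_system T) {FF : Filter F} (b : Prop) (Q : T -> Prop) :
  (b -> \forall x \near F, Q x) -> \forall x \near F, b -> Q x.
Proof.
by move=> bQ; case: (pselect b) => [/bQ|nb]; [apply: filterS|exact: nearW].
Qed.

Section Separation.
Variables (R : realType).
Implicit Types (K F : set (R * R)) (z w : R * R).

(** Phrased with a filter so that finitely many gaps can be taken at once. *)
Lemma compact_closed_gap K F : compact K -> closed F -> K `&` F = set0 ->
  \forall e \near 0^'+, forall z w, K z -> F w -> e < `|z - w|.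
Proof.
move=> cK cF KF.
have cov : forall x, K x -> \forall z \near x & e \near (0:R)^'+,
    forall w, F w -> e < `|z - w|.
  move=> x Kx; have Fx : (~` F) x by move=> Fx; have : (K `&` F) x by []; rewrite KF.
  have /nbhs_ballP[r /= r0 rF] := open_nbhs_nbhs (conj (closed_openC cF) Fx).
  exists (ball x (r / 2), [set e | e < r / 2]) => /=.
    split; first by apply: nbhsx_ballx; rewrite divr_gt0.
    by apply: nbhs_right_lt; rewrite divr_gt0.
  move=> [z e] [/= xz er] w Fw; rewrite ltNge; apply/negP => zw.
  apply: (rF w) => //; rewrite -ball_normE /=.
  rewrite (_ : x - w = (x - z) + (z - w)); last by rewrite addrA subrK.
  apply: (le_lt_trans (ler_normD _ _)).
  rewrite [r]splitr; apply: ltrD.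
    by move: xz; rewrite -ball_normE.
  exact: le_lt_trans er.
have /compact_near_coveringP := cK.
move=> /(_ _ _ (fun e z => forall w, F w -> e < `|z - w|) _ cov) H.
by apply: filterS H => e He z w Kz Fw; apply: He.
Qed.

(** Cells are closed, so that two cells with a common point of K are joined by
cells that also meet K, even when they only share a corner. *)
Definition square (M e : R) N (v : cell N) : set (R * R) :=
  [set z | (-M + v.1%:R * e <= z.1 <= -M + v.1.+1%:R * e) &&
           (-M + v.2%:R * e <= z.2 <= -M + v.2.+1%:R * e)].

Definition hits M e N K : pred (cell N) := fun v => `[< K `&` square M e v !=set0 >].

Lemma square_closed M e N (v : cell N) : closed (square M e v).
Proof.
rewrite (_ : square M e v =
  (fst @^-1` `[-M + v.1%:R * e, -M + v.1.+1%:R * e]) `&`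
  (snd @^-1` `[-M + v.2%:R * e, -M + v.2.+1%:R * e])).
  apply: closedI.
    by apply: (continuous_closedP _).1; [move=> z; exact: cvg_fst|exact: interval_closed].
  by apply: (continuous_closedP _).1; [move=> z; exact: cvg_snd|exact: interval_closed].
by apply/seteqP; split=> z /=; rewrite /square /= !in_itv /=; [move/andP|move=> [-> ->]].
Qed.

(** The norm of the product is the maximum norm, for which a square is a ball. *)
Lemma square_diam M e N (v : cell N) z w : square M e v z -> square M e v w ->
  `|z - w| <= e.
Proof.
move=> /andP[/andP[a1 a2] /andP[a3 a4]] /andP[/andP[b1 b2] /andP[b3 b4]].
rewrite /Num.norm /= ge_max !ler_norml.
move: a2 a4 b2 b4; rewrite -(natr1 v.1) -(natr1 v.2) !mulrDl mul1r => *.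
by apply/andP; split; apply/andP; split; lra.
Qed.

Lemma square_cover M e N z : 0 < e -> 2 * M < N%:R * e -> `|z| <= M ->
  exists v : cell N, square M e v z.
Proof.
move=> e0 NM; rewrite /Num.norm /= ge_max !ler_norml => /andP[/andP[a b] /andP[c d]].
have ix (t : R) : - M <= t -> t <= M ->
    exists i : 'I_N, -M + i%:R * e <= t <= -M + i.+1%:R * e.
  move=> Mt tM; have te : 0 <= (t + M) / e by rewrite divr_ge0 ?(ltW e0) //; lra.
  have := truncn_itv te; have : (Num.truncn ((t + M) / e) < N)%N.
    by rewrite truncn_lt_nat // ltr_pdivrMr //; lra.
  move: (Num.truncn _) => k kN; rewrite ler_pdivlMr // ltr_pdivrMr //.
  rewrite -natr1 mulrDl mul1r => /andP[l r].
  exists (Ordinal kN); rewrite /= -natr1 mulrDl mul1r.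
  by apply/andP; split; lra.
have [i hi] := ix _ a b; have [j hj] := ix _ c d.
by exists (i, j); rewrite /square /= hi hj.
Qed.


Lemma gstep_hor N (i i' j : 'I_N) : (i <= i'.+1)%N -> (i' <= i.+1)%N -> i != i' ->
  gstep N (i, j) (i', j).
Proof.
move=> ii' i'i ne.
have : (i.+1 == i' \/ i'.+1 == i)%N.
  by case: (ltngtP i i') => h; [left; lia|right; lia|move: ne; rewrite -val_eqE /= h eqxx].
case=> /eqP e; apply/existsP.
  exists ((i, j), (false, false)); rewrite drot_valid /=; apply/and3P; split=> //.
    by rewrite e.
  rewrite /drev /= /dsrc /= xpair_eqE eqxx andbT -val_eqE /=.
  by rewrite e modn_small.
exists ((i, j), (false, true)); rewrite drot_valid /=; apply/and3P; split=> //.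
  by rewrite -e.
rewrite /drev /= /dsrc /= xpair_eqE eqxx andbT -val_eqE /=.
by rewrite -e /= modnDr modn_small.
Qed.

Lemma gstep_ver N (i j j' : 'I_N) : (j <= j'.+1)%N -> (j' <= j.+1)%N -> j != j' ->
  gstep N (i, j) (i, j').
Proof.
move=> ii' i'i ne.
have : (j.+1 == j' \/ j'.+1 == j)%N.
  by case: (ltngtP j j') => h; [left; lia|right; lia|move: ne; rewrite -val_eqE /= h eqxx].
case=> /eqP e; apply/existsP.
  exists ((i, j), (true, false)); rewrite drot_valid /=; apply/and3P; split=> //.
    by rewrite e.
  rewrite /drev /= /dsrc /= xpair_eqE eqxx /= -val_eqE /=.
  by rewrite e modn_small.
exists ((i, j), (true, true)); rewrite drot_valid /=; apply/and3P; split=> //.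
  by rewrite -e.
rewrite /drev /= /dsrc /= xpair_eqE eqxx /= -val_eqE /=.
by rewrite -e /= modnDr modn_small.
Qed.

Lemma gstep_sym N : symmetric (gstep N).
Proof. apply: step_sym; [exact: drevK|exact: dvalid_rev]. Qed.

Lemma gconnect_sym N S : connect_sym (gwithin N S).
Proof. apply: connect_within_sym; [exact: drevK|exact: dvalid_rev]. Qed.

(** A corner is avoided by stepping first horizontally, then vertically: the
intermediate cell contains the common point z as well. *)
Lemma square_meet M e N K (v w : cell N) z : 0 < e -> K z ->
  square M e v z -> square M e w z -> connect (gwithin N (hits M e K)) v w.
Proof.
move=> e0 Kz; case: v w => [i j] [i' j'] /andP[/= iz jz] /andP[/= iz' jz'].
have close (k k' : 'I_N) (t : R) : -M + k%:R * e <= t <= -M + k.+1%:R * e ->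
    -M + k'%:R * e <= t <= -M + k'.+1%:R * e -> (k <= k'.+1)%N.
  move=> /andP[h _] /andP[_ h'].
  by rewrite -(ler_nat R) -(ler_pM2r e0); lra.
have Kh (k : 'I_N) (l : 'I_N) : (-M + k%:R * e <= z.1 <= -M + k.+1%:R * e) ->
    (-M + l%:R * e <= z.2 <= -M + l.+1%:R * e) -> hits M e K (k, l).
  by move=> hk hl; apply/asboolP; exists z; rewrite /square /= hk hl.
apply: (@connect_trans _ _ (i', j)).
  have [->//|ne] := eqVneq i i'; apply: connect1.
  by rewrite /= !Kh // gstep_hor //; [exact: close iz iz'|exact: close iz' iz].
have [->//|ne] := eqVneq j j'; apply: connect1.
by rewrite /= !Kh // gstep_ver //; [exact: close jz jz'|exact: close jz' jz].
Qed.

(** Otherwise the cells that can be reached from u and those that cannot would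
cover K by two closed sets, which are disjoint on K by [square_meet]. *)
Lemma connected_hits M e N K (u v : cell N) : 0 < e -> 2 * M < N%:R * e ->
    (forall z, K z -> `|z| <= M) -> connected K ->
    hits M e K u -> hits M e K v ->
  connect (gwithin N (hits M e K)) u v.
Proof.
move=> e0 NM KM cK hu hv.
(* b tells the cells that u can reach from the others. *)
pose near b := [set w : cell N | connect (gwithin N (hits M e K)) u w = b].
pose U b := \bigcup_(w in near b `&` [set w | hits M e K w]) square M e w.
have cU b : closed (U b).
  apply: closed_bigcup; first exact: finite_finset.
  by move=> w _; exact: square_closed.
have KU z : K z -> U true z \/ U false z.
  move=> Kz; have [w wz] := square_cover e0 NM (KM z Kz).
  have hw : hits M e K w by apply/asboolP; exists z.
  by case E: (connect (gwithin N (hits M e K)) u w); [left|right]; exists w.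
have disj z : K z -> U true z -> U false z -> False.
  move=> Kz [w [/= uw hw] wz] [w' [/= uw' hw'] wz'].
  have := square_meet e0 Kz wz wz'.
  by move/(connect_trans uw); rewrite uw'.
have /asboolP[zu [Kzu uz]] := hu; have /asboolP[zv [Kzv vz]] := hv.
have Kt : K `&` U true = K.
  apply: cK; [| |by exists (U true)].
    by exists zu; split=> //; exists u => //; split=> //=; exact: connect0.
  exists (~` U false); first exact: closed_openC.
  apply/seteqP; split=> z [Kz Uz]; split=> //.
    by move=> Uf; exact: disj Uz Uf.
  by case: (KU z Kz).
have : (K `&` U true) zv by rewrite Kt.
case=> _ [w [/= uw hw] wz].
exact: connect_trans uw (square_meet e0 Kzv wz vz).
Qed.

(** Cutting a path at its first cell in O leaves a step out of O, from o to c, and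
a path that connects u with c outside O. *)
Lemma first_entry N (S O : pred (cell N)) u v :
    connect (gwithin N S) u v -> S u -> ~~ O u -> O v ->
  exists c o, [/\ gstep N o c, S c, ~~ O c, O o &
    connect (gwithin N (fun a => S a && ~~ O a)) u c].
Proof.
move=> /connectP[p + ->]; elim: p u => [|w p IH] u /=.
  by move=> _ _ /negbTE ->.
case/andP=> /and3P[uw _ Sw] pw Su Ou Ov.
have [Ow|Ow] := boolP (O w).
  by exists u, w; rewrite gstep_sym uw Su Ou.
have [c [b [bc Sc Oc Ob wc]]] := IH w pw Sw Ow Ov.
exists c, b; split=> //; apply: connect_trans wc; apply: connect1.
by rewrite /= uw Su Ou Sw Ow.
Qed.

End Separation.

(** * Reading a vertex numbering off a hub with spokes *)

(** A one-page book embedding: with the vertices on a line, the edges can be drawn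
as disjoint arcs on one side of it. *)
Definition one_page (G : sgraph) (pos : G -> nat) : Prop :=
  injective pos /\
  forall a b c d : G, adj a c -> adj b d ->
    (pos a < pos b)%N -> (pos b < pos c)%N -> (pos c < pos d)%N -> False.

Lemma edge_ends_proof (G : sgraph) (u v : G) : adj u v -> is_edge [set u; v]%SET.
Proof.
move=> uv; apply/existsP; exists u; apply/existsP; exists v.
by rewrite uv eqxx.
Qed.

Definition edge_ends (G : sgraph) (u v : G) (uv : adj u v) : edge G :=
  exist _ [set u; v]%SET (edge_ends_proof uv).

(** The hub O, the spokes P v from p v to the hub, and for each edge e a continuum
C e through the points p of its ends. A spoke may meet the hub in many points, and
may meet the sets C of the edges at v elsewhere too; p v is where it is joined to
all of them. *)
Section Spokes.
Variables (R : realType) (G : sgraph).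
Variables (O : set (R * R)) (p : G -> R * R).
Variables (P : G -> set (R * R)) (C : edge G -> set (R * R)).
Hypotheses (cO : compact O) (cP : forall v, compact (P v))
  (cC : forall e, compact (C e)).
Hypotheses (kO : connected O) (kP : forall v, connected (P v))
  (kC : forall e, connected (C e)).
Hypotheses (Pp : forall v, P v (p v)) (PO : forall v, P v `&` O !=set0)
  (Op : forall v, ~ O (p v)) (Cp : forall (e : edge G) v, v \in val e -> C e (p v)).
Hypotheses (CO : forall e, C e `&` O = set0)
  (PP : forall u v, u != v -> P u `&` P v = set0)
  (PC : forall v (e : edge G), v \notin val e -> P v `&` C e = set0)
  (CC : forall (e f : edge G), (forall v, v \in val e -> v \notin val f) -> C e `&` C f = set0).

(** On a fine grid the cells of each spoke contain a path from the cell of p v that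
stops at the first cell of the hub; its last step, reversed, is a dart t v that leaves the hub.
The numbering is the position of t v on the walk around a spanning tree of the
cells of the hub. For interleaved edges ac and bd, the spokes and the sets C of
the two edges give connections that contradict [interlaced_connections_meet]. *)
Lemma spokes_one_page : exists pos : G -> nat, one_page pos.
Proof.
have [v0 _|G0] := pickP (@predT G); last first.
  by exists (fun=> 0%N); split=> [u|a]; [have := G0 u|have := G0 a].
have clO := compact_closed (@norm_hausdorff _ _) cO.
have clP v := compact_closed (@norm_hausdorff _ _) (@cP v).
have clC e := compact_closed (@norm_hausdorff _ _) (@cC e).
pose bnd K (M : R) := forall z : R * R, K z -> `|z| <= M.
have [M [M0 bO bP bC]] : exists M : R, [/\ 0 <= M, bnd O M,
    forall v, bnd (P v) M & forall e, bnd (C e) M].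
  have bn K : compact K -> \forall M \near +oo, bnd K M.
    by move=> /compact_bounded.
  near (+oo : set_system R) => M; exists M; split.
  - by near: M; exact: nbhs_pinfty_ge.
  - by near: M; exact: bn.
  - by near: M; apply: filter_forall => v; exact: bn.
  - by near: M; apply: filter_forall => e; exact: bn.
pose gap e (K F : set (R * R)) := forall z w, K z -> F w -> e < `|z - w|.
have [e [e0 gp gC gPP [gPC gCC]]] : exists e : R, [/\ 0 < e, forall v, gap e [set p v] O,
    forall f, gap e (C f) O, forall u v, u != v -> gap e (P u) (P v) &
    (forall v (f : edge G), v \notin val f -> gap e (P v) (C f)) /\
    (forall (f g : edge G), (forall v, v \in val f -> v \notin val g) -> gap e (C f) (C g))].
  near (0:R)^'+ => e; exists e; split; last split.
  - by near: e; exact: nbhs_right_gt.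
  - near: e; apply: filter_forall => v; apply: compact_closed_gap => //.
      exact: compact_set1.
    by apply/seteqP; split=> z //= [-> /Op].
  - by near: e; apply: filter_forall => f; apply: compact_closed_gap.
  - near: e; apply: filter_forall => u; apply: filter_forall => v.
    by apply: near_implies => uv; apply: compact_closed_gap => //; exact: PP.
  - near: e; apply: filter_forall => u; apply: filter_forall => f.
    by apply: near_implies => uv; apply: compact_closed_gap => //; exact: PC.
  - near: e; apply: filter_forall => f; apply: filter_forall => g.
    by apply: near_implies => fg; apply: compact_closed_gap => //; exact: CC.
(* N cells per side cover the box that contains the whole configuration. *)
pose N := (Num.truncn (2 * M / e)).+1.
have NM : 2 * M < N%:R * e by rewrite -ltr_pdivrMr //; exact: truncnS_gt.
have unhit K F (v : cell N) : gap e K F -> hits M e K v -> hits M e F v -> False.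
  move=> KF /asboolP[z [Kz vz]] /asboolP[w [Fw vw]].
  by have := square_diam vz vw; rewrite leNgt KF.
have /choice[pc pcP] v : exists w : cell N, square M e w (p v).
  by apply: square_cover; rewrite // ?(bP v).
have PhP v : hits M e (P v) (pc v) by apply/asboolP; exists (p v).
have OhP v : ~~ hits M e O (pc v).
  apply/negP; apply: (unhit _ _ _ (gp v)).
  by apply/asboolP; exists (p v).
have /choice[t tP] v : exists t : dart N, [/\ inside t, hits M e O (dsrc t),
    ~~ hits M e O (dtgt t), hits M e (P v) (dtgt t) &
    connect (gwithin N
      (fun a => hits M e (P v) a && ~~ hits M e O a)) (pc v) (dtgt t)].
  have [z [Pz Oz]] := PO v.
  have [w zw] : exists w : cell N, square M e w z.
    by apply: square_cover; rewrite // ?(bP v).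
  have hPw : hits M e (P v) w by apply/asboolP; exists z.
  have hOw : hits M e O w by apply/asboolP; exists z.
  have := connected_hits e0 NM (bP v) (@kP v) (PhP v) hPw.
  move=> /first_entry/(_ (PhP v) (OhP v) hOw) [c [b [bc Sc Oc Ob pcc]]].
  have /existsP[t /and3P[tv /eqP tb /eqP tc]] := bc.
  exists t; rewrite drot_valid in tv.
  have {}tc : dtgt t = c := tc.
  by split; rewrite ?tc ?tb.
have [T [L [E [tT TO]]]] : exists T L E,
    thick_tree (@dsrc N) (@drev N) (@drot N) T L E /\ T =i hits M e O.
  have [_ O0 _ _ _] := tP v0.
  apply: (tree_exists (@drevK N) (@drot_uniq N) (@drot_src N) (@dvalid_rev N) O0).
  by move=> u Ou; apply: connected_hits.
have tL v : t v \in L.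
  have [tv Ot Oc _ _] := tP v.
  have [_ _ /(_ (t v))] := tree_boundary (@drevK N) (@drot_uniq N) (@drot_src N) tT.
  rewrite drot_valid => /(_ tv); rewrite TO => /(_ Ot).
  rewrite mem_cat => /orP[//|/(tree_dart_ends (@drevK N) (@drot_src N) tT)/andP[_]].
  by rewrite TO; move: Oc; rewrite /dsrc /drev /= /in_mem /= => /negbTE ->.
exists (fun v => index (t v) L); split.
  move=> u v uv; apply/eqP; apply: contraT => /gPP/unhit nPP.
  have [_ _ _ Pu _] := tP u; have [_ _ _ Pv _] := tP v.
  have tuv : t u = t v by rewrite -(nth_index (t u) (tL u)) uv nth_index.
  by case: (nPP _ Pu); rewrite tuv.
move=> a b c d ac bd ab bc cd.
(* The cells of the two spokes and of the edge, outside the hub. *)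
pose via u v (uv : adj u v) := [pred w : cell N |
  [|| hits M e (P u) w, hits M e (C (edge_ends uv)) w | hits M e (P v) w] &&
  ~~ hits M e O w].
have joined u v (uv : adj u v) :
    connect (gwithin N (via u v uv)) (dtgt (t u)) (dtgt (t v)).
  have hC w : w \in val (edge_ends uv) -> hits M e (C (edge_ends uv)) (pc w).
    by move=> we; apply/asboolP; exists (p w); split; [exact: Cp|exact: pcP].
  have ue : u \in val (edge_ends uv) by rewrite !inE eqxx.
  have ve : v \in val (edge_ends uv) by rewrite !inE eqxx orbT.
  have [_ _ _ _ up] := tP u; have [_ _ _ _ vp] := tP v.
  apply: (@connect_trans _ _ (pc u)).
    rewrite gconnect_sym; apply: connect_withinS up => w /andP[Pw Ow].
    by apply/andP; split=> //; apply/or3P; constructor 1.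
  apply: (@connect_trans _ _ (pc v)); last first.
    apply: connect_withinS vp => w /andP[Pw Ow].
    by apply/andP; split=> //; apply/or3P; constructor 3.
  have := connected_hits e0 NM (bC _) (@kC (edge_ends uv)) (hC _ ue) (hC _ ve).
  apply: connect_withinS => w Cw; apply/andP; split.
    by apply/or3P; constructor 2.
  by apply/negP; exact: unhit (gC _) Cw.
have ends u v (uv : adj u v) : via u v uv (dtgt (t u)) /\ via u v uv (dtgt (t v)).
  have [_ _ uO uP _] := tP u; have [_ _ vO vP _] := tP v.
  by split; apply/andP; split=> //; apply/or3P; [constructor 1|constructor 3].
have off u v (uv : adj u v) w : via u v uv w -> w \notin T.
  by case/andP=> _ Ow; rewrite TO.
have ne u v : (index (t u) L < index (t v) L)%N -> u != v.
  by apply: contraTneq => ->; rewrite ltnn.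
have [nab nbc ncd] := And3 (ne _ _ ab) (ne _ _ bc) (ne _ _ cd).
have nad : a != d by apply: ne; apply: ltn_trans ab (ltn_trans bc cd).
have disj w : via _ _ ac w -> ~~ via _ _ bd w.
  move=> /andP[acw _]; apply/negP => /andP[bdw _].
  case/or3P: acw => hw; case/or3P: bdw => hw'.
  - exact: unhit (gPP _ _ nab) hw hw'.
  - by apply: unhit (gPC _ _ _) hw hw'; rewrite !inE negb_or nab nad.
  - exact: unhit (gPP _ _ nad) hw hw'.
  - by apply: unhit (gPC _ _ _) hw' hw; rewrite !inE negb_or eq_sym nab nbc.
  - apply: unhit (gCC _ _ _) hw hw' => x; rewrite !inE negb_or.
    by case/orP=> /eqP ->; rewrite ?nab ?nad // eq_sym nbc ncd.
  - by apply: unhit (gPC _ _ _) hw' hw; rewrite !inE negb_or eq_sym nad eq_sym ncd.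
  - by apply: unhit (gPP _ _ _) hw hw'; rewrite eq_sym nbc.
  - by apply: unhit (gPC _ _ _) hw hw'; rewrite !inE negb_or eq_sym nbc ncd.
  - exact: unhit (gPP _ _ ncd) hw hw'.
have [va vc] := ends _ _ ac; have [vb vd] := ends _ _ bd.
exact: (interlaced_connections_meet (@drevK N) (@drot_uniq N) (@drot_src N)
  (@dvalid_rev N) (@grid_planar N) tT ab bc cd (tL d) va vc vb vd
  (off _ _ ac) (off _ _ bd) disj (joined _ _ ac) (joined _ _ bd)).
Unshelve. all: by end_near. Qed.
End Spokes.

(** * Outer-string models *)

Section PlaneSets.
Variable R : realType.
Implicit Types (a b c z : R * R) (r t : R).

Lemma continuous_coords (f g : R -> R) : continuous f -> continuous g ->
  continuous (fun t => (f t, g t) : R * R).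
Proof.
move=> cf cg t.
exact: (@cvg_pair _ _ _ (nbhs t) (nbhs (f t)) (nbhs (g t)) _ _ _ f g (cf t) (cg t)).
Qed.

Lemma curve_compact (f : R -> R * R) s t : {within `[s, t], continuous f} ->
  compact (f @` `[s, t]).
Proof. by move=> cf; apply: continuous_compact => //; exact: segment_compact. Qed.

Lemma curve_connected (f : R -> R * R) s t : {within `[s, t], continuous f} ->
  connected (f @` `[s, t]).
Proof.
by move=> cf; apply: connected_continuous_connected => //; exact: segment_connected.
Qed.

Lemma segment_coords a b t : (1 - t) *: a + t *: b =
  ((1 - t) * a.1 + t * b.1, (1 - t) * a.2 + t * b.2).
Proof. by case: a b => [a1 a2] [b1 b2]. Qed.

Lemma segment_continuous a b : continuous (fun t : R => (1 - t) *: a + t *: b).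
Proof.
rewrite (_ : (fun t : R => _) =
    fun t => ((1 - t) * a.1 + t * b.1, (1 - t) * a.2 + t * b.2)); last first.
  by apply/funext => t; exact: segment_coords.
have aff (p q : R) : continuous (fun t : R => (1 - t) * p + t * q).
  move=> t; apply: cvgD; apply: cvgM; try exact: cvg_cst; try exact: cvg_id.
  by apply: cvgB; [exact: cvg_cst|exact: cvg_id].
by apply: continuous_coords.
Qed.

Lemma line_segment_compact a b : compact (segment a b).
Proof. apply: curve_compact; exact/continuous_subspaceT/segment_continuous. Qed.

Lemma line_segment_connected a b : connected (segment a b).
Proof. apply: curve_connected; exact/continuous_subspaceT/segment_continuous. Qed.

Lemma segmentl a b : segment a b a.
Proof.
exists 0; first by rewrite /= in_itv /= lexx ler01.
by rewrite subr0 scale1r scale0r addr0.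
Qed.

Lemma segmentr a b : segment a b b.
Proof.
exists 1; first by rewrite /= in_itv /= lexx ler01.
by rewrite subrr scale1r scale0r add0r.
Qed.

(** The arc cosine reaches the upper half of the circle; the lower half is its
mirror image. *)
Lemma circle_param c r : 0 <= r ->
  circle c r = (fun t => (c.1 + r * cos t, c.2 + r * sin t)) @` `[-pi, pi].
Proof.
move=> r0; apply/seteqP; split=> [[x y]|_ [t _ <-]]; rewrite /circle /sqdist /=; last first.
  rewrite ![_ + _ * _ - _]addrAC !subrr !add0r !exprMn -mulrDr.
  by rewrite cos2Dsin2 mulr1.
move=> e; have [r_eq0|rn] := eqVneq r 0.
  exists 0; first by rewrite /= in_itv /= oppr_le0 pi_ge0.
  move: e; rewrite r_eq0 expr0n /= !mul0r !addr0 => /eqP.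
  rewrite paddr_eq0 ?sqr_ge0 // !sqrf_eq0 !subr_eq0 => /andP[/eqP-> /eqP->].
  by [].
pose u := (x - c.1) / r; pose v := (y - c.2) / r.
have xu : x = c.1 + r * u by rewrite /u mulrCA divff // mulr1 addrC subrK.
have yv : y = c.2 + r * v by rewrite /v mulrCA divff // mulr1 addrC subrK.
have uv : u ^+ 2 + v ^+ 2 = 1.
  by rewrite /u /v !exprMn -mulrDl e -exprMn divff // expr1n.
have u1 : -1 <= u <= 1.
  rewrite -ler_norml -(@ler_pXn2r _ 2) ?nnegrE // real_normK ?num_real // expr1n.
  by rewrite -uv lerDl sqr_ge0.
have sv : Num.sqrt (1 - u ^+ 2) = `|v|.
  by rewrite -uv addrAC subrr add0r sqrtr_sqr.
have api := acos_lepi u1; have a0 := acos_ge0 u1.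
have ca : cos (acos u) = u by rewrite acosK // in_itv.
have [v0|v0] := leP 0 v.
  exists (acos u); first by rewrite /= in_itv /= api andbT (le_trans _ a0) // oppr_le0 pi_ge0.
  by rewrite ca sin_acos // sv ger0_norm // -xu -yv.
exists (- acos u).
  by rewrite /= in_itv /= lerN2 api /= (le_trans _ (pi_ge0 R)) // oppr_le0.
by rewrite cosN sinN ca sin_acos // sv ltr0_norm // opprK -xu -yv.
Qed.

Lemma circle_param_continuous c r :
  continuous (fun t => (c.1 + r * cos t, c.2 + r * sin t) : R * R).
Proof.
apply: continuous_coords => t; apply: cvgD; try exact: cvg_cst.
  by apply: cvgM; [exact: cvg_cst|exact: continuous_cos].
by apply: cvgM; [exact: cvg_cst|exact: continuous_sin].
Qed.

Lemma circle_compact c r : 0 <= r -> compact (circle c r).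
Proof.
move=> r0; rewrite circle_param //; apply: curve_compact.
exact/continuous_subspaceT/circle_param_continuous.
Qed.

Lemma circle_connected c r : 0 <= r -> connected (circle c r).
Proof.
move=> r0; rewrite circle_param //; apply: curve_connected.
exact/continuous_subspaceT/circle_param_continuous.
Qed.

End PlaneSets.

Lemma edge_endsP (G : sgraph) (e : edge G) :
  exists u v : G, adj u v /\ val e = [set u; v]%SET.
Proof.
case: e => e /= /existsP[u /existsP[v /andP[uv /eqP ->]]].
by exists u, v.
Qed.

Lemma adj_neq (G : sgraph) (u v : G) : adj u v -> u != v.
Proof. by apply: contraTneq => ->; rewrite adj_irrefl. Qed.

Section Strings.
Variables (R : realType) (G : sgraph).

(** A string may return to the boundary circle many times, so the circle itself
cannot serve as the hub. A concentric circle of twice the radius can: the string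
of v is prolonged from one chosen boundary point p v by a radial segment to that
circle. *)
Lemma outer_string_one_page :
  outer_string_graph R (subdivision1 G) -> exists pos : G -> nat, one_page pos.
Proof.
case=> c [r [r0 [F [Fs [phi [[phiF phi_inj _] phi_adj]]]]]].
have str x : is_outer_string c r (phi x) by apply: Fs; exact: phiF.
have kphi x : connected (phi x).
  by have [f [cf _ _ ->]] := str x; exact: curve_connected.
have cphi x : compact (phi x).
  by have [f [cf _ _ ->]] := str x; exact: curve_compact.
have dphi x z : phi x z -> sqdist z c <= r ^+ 2.
  by have [f [_ _ h _]] := str x; exact: h.
have apart (x y : subdivision1 G) z : x != y -> ~~ adj x y -> phi x z -> phi y z -> False.
  move=> xy nxy xz yz; move/negP: nxy; apply; apply/phi_adj; split; last by exists z.
  by move=> /phi_inj; rewrite !in_setT => /(_ isT isT) /eqP; rewrite (negbTE xy).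
have /choice[p pP] v : exists z, phi (inl v) z /\ circle c r z.
  have [f [_ f0 _ ->]] := str (inl v); exists (f 0); split=> //.
  by exists 0 => //=; rewrite in_itv /= lexx ler01.
have /choice[g gP] (e : edge G) : exists uv : G * G,
    adj uv.1 uv.2 /\ val e = [set uv.1; uv.2]%SET.
  by have [u [v uvE]] := edge_endsP e; exists (u, v).
(* The radial prolongation of p v ends on the circle of radius 2 r. *)
pose q v := (2 * (p v).1 - c.1, 2 * (p v).2 - c.2).
pose P v := segment (p v) (q v).
pose C e := phi (inl (g e).1) `|` phi (inr e) `|` phi (inl (g e).2).
have PE v z : P v z -> exists2 t, 0 <= t <= 1 &
    z.1 - c.1 = (1 + t) * ((p v).1 - c.1) /\ z.2 - c.2 = (1 + t) * ((p v).2 - c.2).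
  case=> t; rewrite /= in_itv /= => t01; rewrite segment_coords /q /= => <-.
  by exists t => //; split=> /=; ring.
have Pdist v z t : z.1 - c.1 = (1 + t) * ((p v).1 - c.1) ->
    z.2 - c.2 = (1 + t) * ((p v).2 - c.2) -> sqdist z c = (1 + t) ^+ 2 * r ^+ 2.
  move=> e1 e2; have [_ pc] := pP v.
  by rewrite -[in RHS]pc /sqdist e1 e2 !exprMn mulrDr.
have r20 : 0 < r ^+ 2 by rewrite exprn_gt0.
have inner_P v z : P v z -> sqdist z c <= r ^+ 2 -> z = p v.
  move=> /PE[t /andP[t0 t1] [e1 e2]]; rewrite (Pdist _ _ _ e1 e2).
  have -> : (1 + t) ^+ 2 * r ^+ 2 = r ^+ 2 + t * ((t + 2) * r ^+ 2) by ring.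
  rewrite gerDl => h; have tz : t = 0.
    apply/eqP; move: t0; rewrite le_eqVlt eq_sym => /orP[//|t0].
    by move: h; rewrite leNgt !mulr_gt0 // addr_gt0.
  move: e1 e2; rewrite tz addr0 !mul1r => /addIr e1 /addIr e2.
  by case: z (p v) e1 e2 => [z1 z2] [p1 p2] /= -> ->.
have Cin e z : C e z -> sqdist z c <= r ^+ 2 by case=> [[]|]; exact: dphi.
have ve (e : edge G) v : (v \in val e) = (v == (g e).1) || (v == (g e).2).
  by have [_ ->] := gP e; rewrite !inE.
have Oout z : circle c (2 * r) z -> sqdist z c <= r ^+ 2 -> False.
  rewrite /circle /= => ->; rewrite exprMn -subr_ge0.
  have -> : r ^+ 2 - 2 ^+ 2 * r ^+ 2 = - (3 * r ^+ 2) by ring.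
  by rewrite oppr_ge0 leNgt mulr_gt0.
have p_in v : sqdist (p v) c <= r ^+ 2 by have [_ ->] := pP v.
have CE (e : edge G) v : v \in val e -> C e (p v).
  rewrite ve => /orP[] /eqP ->; first by left; left; have [] := pP (g e).1.
  by right; have [] := pP (g e).2.
have kC e : connected (C e).
  have [/= guv ge] := gP e.
  have meets v : v \in val e -> (phi (inl v) `&` phi (inr e)) !=set0.
    by move=> vE; have [|_] := (phi_adj (inl v) (inr e)).1.
  have m1 : (phi (inl (g e).1) `&` phi (inr e)) !=set0 by apply: meets; rewrite ve eqxx.
  have m2 : (phi (inl (g e).2) `&` phi (inr e)) !=set0 by apply: meets; rewrite ve eqxx orbT.
  apply: connectedU => //; last exact: connectedU.
  by case: m2 => z [z1 z2]; exists z; split=> //; right.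
apply: (@spokes_one_page R G (circle c (2 * r)) p P C).
- by apply: circle_compact; rewrite mulr_ge0 // ltW.
- by move=> v; exact: line_segment_compact.
- by move=> e; apply: compactU => //; apply: compactU.
- by apply: circle_connected; rewrite mulr_ge0 // ltW.
- by move=> v; exact: line_segment_connected.
- by [].
- by move=> v; exact: segmentl.
- move=> v; exists (q v); split; first exact: segmentr.
  have [_ pc] := pP v; rewrite /circle /= exprMn -[in RHS]pc /sqdist /q /=; ring.
- by move=> v /Oout; apply.
- exact: CE.
- by move=> e; apply/seteqP; split=> z // -[/Cin Cz /Oout]; exact.
- move=> u v uv; apply/seteqP; split=> z // -[Pu Pv].
  have [s /andP[s0 _] [s1 s2]] := PE _ _ Pu; have [t /andP[t0 _] [t1 t2]] := PE _ _ Pv.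
  have st : 1 + s = 1 + t.
    have := Pdist _ _ _ s1 s2; rewrite (Pdist _ _ _ t1 t2).
    move/(mulIf (lt0r_neq0 r20))/eqP.
    by rewrite eqrXn2 ?addr_ge0 // => /eqP.
  have sn : 1 + s != 0 by rewrite gt_eqF // ltr_pwDl.
  move: t1 t2; rewrite s1 s2 -st => /(mulfI sn)/addIr e1 /(mulfI sn)/addIr e2.
  have euv : p u = p v by case: (p u) (p v) e1 e2 => [? ?] [? ?] /= -> ->.
  have [pu _] := pP u; have [pv _] := pP v.
  by apply: (apart (inl u) (inl v) (p u)) => //; rewrite euv.
- move=> v e; rewrite ve negb_or => /andP[v1 v2]; apply/seteqP; split=> z // -[Pz Cz].
  have zp := inner_P _ _ Pz (Cin _ _ Cz); have [pv _] := pP v.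
  case: Cz => [[]|] Cz.
  + by apply: (apart (inl v) (inl (g e).1) z) => //; rewrite zp.
  + apply: (apart (inl v) (inr e) z) => //; last by rewrite zp.
    by rewrite /= ve negb_or v1 v2.
  + by apply: (apart (inl v) (inl (g e).2) z) => //; rewrite zp.
- move=> e f ef; apply/seteqP; split=> z // -[Ce Cf].
  have e1 : (g e).1 \notin val f by apply: ef; rewrite ve eqxx.
  have e2 : (g e).2 \notin val f by apply: ef; rewrite ve eqxx orbT.
  have f1 : (g f).1 \notin val e.
    by apply/negP => /ef; rewrite ve eqxx.
  have f2 : (g f).2 \notin val e.
    by apply/negP => /ef; rewrite ve eqxx orbT.
  have nef : inr e != inr f :> subdivision1 G.
    by apply: contraNneq e1 => -[<-]; rewrite ve eqxx.
  move: (e1) (e2); rewrite !ve !negb_or => /andP[e11 e12] /andP[e21 e22].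
  case: Ce => [[]|] Ce; case: Cf => [[]|] Cf; apply: (apart _ _ z _ _ Ce Cf) => //.
Qed.
End Strings.

(** * Outerplanar drawings *)

Section Face.
Variable R : realType.
Implicit Types (a b z : R * R) (A U : set (R * R)) (e : R).

Lemma segment_in_ball a b e z : `|a - b| < e -> segment a b z -> `|a - z| < e.
Proof.
move=> ab [t]; rewrite /= in_itv /= => /andP[t0 t1] <-.
have -> : a - ((1 - t) *: a + t *: b) = t *: (a - b).
  by rewrite scalerBl scale1r opprD opprB addrA [a + (_ - a)]addrC subrK scalerBr.
rewrite normrZ ger0_norm //; apply: le_lt_trans ab.
by rewrite ler_piMl.
Qed.

Lemma open_segment U a : open U -> U a ->
  exists2 e, 0 < e & forall b, `|a - b| < e -> U b /\ segment a b `<=` U.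
Proof.
move=> oU Ua; have /nbhs_ballP[e /= e0 eU] := open_nbhs_nbhs (conj oU Ua).
have bU b : `|a - b| < e -> U b by move=> ab; apply: eU; rewrite -ball_normE.
exists e => // b ab; split; first exact: bU.
by move=> z /(segment_in_ball ab)/bU.
Qed.

Lemma open_component U z : open U -> open (connected_component U z).
Proof.
move=> oU; rewrite openE => a Ca.
have [e e0 eU] := open_segment oU (connected_component_sub Ca).
apply/nbhs_ballP; exists e => //= b; rewrite -ball_normE /= => /eU[_ sU].
apply: (connected_component_trans Ca).
exists (segment a b); last exact: segmentr.
by split=> //; [exact: segmentl|exact: line_segment_connected].
Qed.

Definition continuum_in A (K : set (R * R)) := [/\ compact K, connected K & K `<=` A].

(** The points of A that some continuum in A joins to a form a set that is open
and closed in A, as every point has a neighbourhood of segments in A. *)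
Lemma continuum_joining A a b : open A -> connected A -> A a -> A b ->
  exists K, [/\ continuum_in A K, K a & K b].
Proof.
move=> oA kA Aa Ab.
pose B := [set z | exists K, [/\ continuum_in A K, K a & K z]].
have BA : B `<=` A by move=> z [K [[_ _ KA] _ Kz]]; exact: KA.
have spread (z w : R * R) : A z -> segment z w `<=` A -> B z <-> B w.
  move=> Az zw; have meet K u : K u -> segment z w u -> continuum_in A K ->
      continuum_in A (K `|` segment z w).
    move=> Ku su [cK kK KA]; split.
    - by apply: compactU => //; exact: line_segment_compact.
    - by apply: connectedU => //; [exists u|exact: line_segment_connected].
    - by move=> y [/KA|/zw].
  split=> -[K [KA Ka Kz]]; exists (K `|` segment z w); split; try by left.
  - exact: meet Kz (segmentl _ _) KA.
  - by right; exact: segmentr.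
  - exact: meet Kz (segmentr _ _) KA.
  - by right; exact: segmentl.
have near_B z : A z -> exists2 e, 0 < e & forall w, `|z - w| < e -> A w /\ (B z <-> B w).
  move=> Az; have [e e0 eA] := open_segment oA Az.
  by exists e => // w /eA[Aw zw]; split=> //; exact: spread.
suff BE : B = A by have : B b by rewrite BE.
apply: kA.
- exists a; exists [set a]; split=> //.
  by split=> [||z -> //]; [exact: compact_set1|exact: connected1].
- exists B; last by apply/seteqP; split=> z; [split=> //; exact: BA|case].
  rewrite openE => z Bz; have [e e0 eB] := near_B z (BA z Bz).
  by apply/nbhs_ballP; exists e => //= w; rewrite -ball_normE => /eB[_ <-].
- exists (~` (A `\` B)); last first.
    apply/seteqP; split=> z; first by move=> Bz; split; [exact: BA|case].
    by case=> Az nAB; apply: contrapT => nB; apply: nAB.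
  apply: open_closedC; rewrite openE => z [Az nBz].
  have [e e0 eB] := near_B z Az.
  apply/nbhs_ballP; exists e => //= w; rewrite -ball_normE => /eB[Aw zw].
  by split=> // /zw.
Qed.

Lemma continuum_through A (I : finType) (q : I -> R * R) a : open A -> connected A ->
  A a -> (forall i, A (q i)) -> exists2 K, continuum_in A K & forall i, K (q i).
Proof.
move=> oA kA Aa Aq.
suff [K [KA Ka Kq]] : exists K, [/\ continuum_in A K, K a &
    forall i, i \in enum I -> K (q i)].
  by exists K => // i; apply: Kq; rewrite mem_enum.
elim: (enum I) => [|i s [K [[cK kK KA] Ka Kq]]].
  exists [set a]; split=> //.
  by split=> [||z -> //]; [exact: compact_set1|exact: connected1].
have [L [[cL kL LA] La Li]] := continuum_joining oA kA Aa (Aq i).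
exists (K `|` L); split; [split| |].
- exact: compactU.
- by apply: connectedU => //; exists a.
- by move=> z [/KA|/LA].
- by left.
- by move=> j; rewrite inE => /orP[/eqP->|/Kq]; [right|left].
Qed.

(** The vertex p v need not be accessible from the face A by a curve in A, because
edges at v may accumulate there. So the spoke of v is a short straight segment
from p v to a point q v of A. It may cross the edges at v, which does no
harm, but it is too short to meet anything else of the drawing. *)
Lemma outerplanar_one_page (G : sgraph) :
  outerplanar R G -> exists pos : G -> nat, one_page pos.
Proof.
case=> p [gam [[p_inj arcs ends meets] [A [[x Dx AE] Acl]]]].
have arc (e : edge G) : [/\ compact (gam e), connected (gam e) &
    forall v, v \in val e -> gam e (p v)].
  have [u [v [uv eE]]] := edge_endsP e.
  have ue : u \in val e by rewrite eE !inE eqxx.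
  have ve : v \in val e by rewrite eE !inE eqxx orbT.
  have [f [cf _ f0 f1 fE]] := arcs e u v (adj_neq uv) ue ve.
  rewrite fE; split; [exact: curve_compact|exact: curve_connected|].
  move=> w; rewrite eE !inE => /orP[] /eqP ->.
    by exists 0 => //=; rewrite in_itv /= lexx ler01.
  by exists 1 => //=; rewrite in_itv /= lexx ler01.
have hR := @norm_hausdorff R (R * R)%type.
have cD : closed (drawing p gam).
  apply: closedU.
    have := hausdorff_accessible hR.
    move/accessible_finite_set_closed; apply.
    by apply: finite_image; exact: finite_finset.
  apply: closed_bigcup; first exact: finite_finset.
  by move=> e _; apply: compact_closed => //; have [] := arc e.
have oA : open A by rewrite AE; apply: open_component; exact: closed_openC.
have kA : connected A by rewrite AE; exact: component_connected.
have AD z : A z -> ~ drawing p gam z by rewrite AE => /connected_component_sub.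
have Ax : A x by rewrite AE; exact: connected_component_refl.
have Dg (e : edge G) z : gam e z -> drawing p gam z by right; exists e.
have [d [d0 dp dg]] : exists d : R, [/\ 0 < d,
    forall u v, u != v -> d < `|p u - p v| / 2 &
    forall v (e : edge G), v \notin val e -> forall z, gam e z -> d < `|p v - z|].
  near (0:R)^'+ => d; exists d; split.
  - by near: d; exact: nbhs_right_gt.
  - near: d; apply: filter_forall => u; apply: filter_forall => v.
    apply: near_implies => uv; apply: nbhs_right_lt.
    by rewrite divr_gt0 // normr_gt0 subr_eq0 (inj_eq p_inj).
  - near: d; apply: filter_forall => v; apply: filter_forall => e.
    apply: near_implies => ve; have [ce _ _] := arc e.
    have : \forall d \near 0^'+, forall z w, [set p v] z -> gam e w -> d < `|z - w|.
      apply: compact_closed_gap; [exact: compact_set1|exact: compact_closed|].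
      by apply/seteqP; split=> z //= [-> /ends]; rewrite (negbTE ve).
    by apply: filterS => d h z; exact: h.
have /choice[q qP] v : exists z, A z /\ `|p v - z| < d.
  have [z [Az bz]] := Acl v (ball (p v) d) (nbhsx_ballx _ _ d0).
  by exists z; split=> //; move: bz; rewrite -ball_normE.
have [K [cK kK KA] Kq] := continuum_through oA kA Ax (fun v => (qP v).1).
pose P v := segment (p v) (q v).
have Pd v z : P v z -> `|p v - z| < d by apply: segment_in_ball; have [] := qP v.
apply: (@spokes_one_page R G K p P gam) => //.
- by move=> v; exact: line_segment_compact.
- by move=> e; have [] := arc e.
- by move=> v; exact: line_segment_connected.
- by move=> e; have [] := arc e.
- by move=> v; exact: segmentl.
- by move=> v; exists (q v); split; [exact: segmentr|exact: Kq].
- by move=> v /KA/AD; apply; left; exists v.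
- by move=> e v ve; have [_ _] := arc e; exact.
- by move=> e; apply/seteqP; split=> z // [/Dg Dz /KA/AD].
- move=> u v uv; apply/seteqP; split=> z // [/Pd uz /Pd vz].
  have := dp u v uv; rewrite ltr_pdivlMr // ltNge; apply/negP; rewrite negbK.
  rewrite (_ : p u - p v = (p u - z) - (p v - z)); last by rewrite opprB addrA subrK.
  apply: le_trans (ler_normB _ _) _; rewrite mulr_natr mulr2n.
  by apply: lerD; exact: ltW.
- move=> v e ve; apply/seteqP; split=> z // [/Pd vz gz].
  by have := dg v e ve z gz; rewrite ltNge ltW.
- move=> e f ef; apply/seteqP; split=> z // [ez fz].
  have nef : e != f.
    have [u [v [_ eE]]] := edge_endsP e.
    apply: contraTneq (ef u _) => [<-|]; last by rewrite eE !inE eqxx.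
    by rewrite negbK eE !inE eqxx.
  have [w _ wz] := meets e f nef z (conj ez fz).
  have we : w \in val e by apply: ends; rewrite wz.
  have wf : w \in val f by apply: ends; rewrite wz.
  by have := ef w we; rewrite wf.
Unshelve. all: by end_near. Qed.
End Face.

(** * Chords of a circle *)

Section Chords.
Variable R : realType.
Implicit Types (a b c z : R * R) (r s t u : R).

(** The point with parameter t is at squared distance
(1-t)|a-c|^2 + t|b-c|^2 - t(1-t)|a-b|^2 from c. *)
Lemma disk_convex c r a b : disk c r a -> disk c r b -> segment a b `<=` disk c r.
Proof.
rewrite /disk /= => da db z [t]; rewrite /= in_itv /= => /andP[t0 t1].
rewrite segment_coords => <-; rewrite /= /sqdist /=.
have -> : ((1 - t) * a.1 + t * b.1 - c.1) ^+ 2 + ((1 - t) * a.2 + t * b.2 - c.2) ^+ 2 =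
  (1 - t) * sqdist a c + t * sqdist b c - t * (1 - t) * sqdist a b.
  by rewrite /sqdist; ring.
have d0 : 0 <= sqdist a b by rewrite addr_ge0 ?sqr_ge0.
have t0' : 0 <= 1 - t by rewrite subr_ge0.
rewrite lerBlDr; apply: (@le_trans _ _ (r ^+ 2)); last first.
  by rewrite lerDl mulr_ge0 // mulr_ge0.
have -> : r ^+ 2 = (1 - t) * r ^+ 2 + t * r ^+ 2 by ring.
by apply: lerD; apply: ler_wpM2l.
Qed.

Lemma chord_outer_segment c r : is_chord c r `<=` is_outer_segment (R:=R) c r.
Proof.
move=> A [a [b [ab ca cb ->]]]; exists a, b; split=> //.
by apply: disk_convex; rewrite /disk /= ?ca ?cb.
Qed.

Lemma outer_segment_string c r : is_outer_segment (R:=R) c r `<=` is_outer_string c r.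
Proof.
move=> A [a [b [ab ca Ad AE]]]; exists (fun t => (1 - t) *: a + t *: b); split=> //.
  exact/continuous_subspaceT/segment_continuous.
by rewrite subr0 scale1r scale0r addr0.
Qed.

(** The rational parametrization of the unit circle: incidences of chords become
polynomial conditions on parameters. *)
Definition circle_pt t : R * R := ((1 - t ^+ 2) / (1 + t ^+ 2), 2 * t / (1 + t ^+ 2)).

Lemma denom_gt0 t : 0 < 1 + t ^+ 2.
Proof. by rewrite ltr_pwDl ?sqr_ge0. Qed.

Lemma denom_neq0 t : 1 + t ^+ 2 != 0.
Proof. by rewrite gt_eqF ?denom_gt0. Qed.

Lemma circle_ptP t : circle (0, 0) 1 (circle_pt t).
Proof.
rewrite /circle /sqdist /= !subr0; have := denom_neq0 t => d; field.
exact: d.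
Qed.

(** The equation of the line through the points s and t. On the circle it becomes
the quadratic polynomial with roots s and t ([side_pt]), so its sign separates
the two arcs. *)
Definition side s t z : R := (1 - z.1) / 2 - (s + t) * z.2 / 2 + s * t * (1 + z.1) / 2.

Lemma side_pt s t u : side s t (circle_pt u) = (u - s) * (u - t) / (1 + u ^+ 2).
Proof. by rewrite /side /=; have := denom_neq0 u => d; field; exact: d. Qed.

Lemma side_affine s t a b u : side s t ((1 - u) *: a + u *: b) =
  (1 - u) * side s t a + u * side s t b.
Proof. by rewrite segment_coords /side /=; field. Qed.

Lemma circle_pt_inj : injective circle_pt.
Proof.
move=> s t [e1 e2].
have := side_pt t t s; rewrite (_ : circle_pt s = circle_pt t); last by rewrite /circle_pt e1 e2.
rewrite side_pt subrr mul0r mul0r => /esym/eqP.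
rewrite !mulf_eq0 invr_eq0 (negbTE (denom_neq0 _)) orbF orbb subr_eq0.
by move/eqP.
Qed.

Definition chord s t := segment (circle_pt s) (circle_pt t).

Lemma chordC s t : chord s t = chord t s.
Proof.
suff sub a b : segment a b `<=` segment b a by apply/seteqP; split; exact: sub.
move=> z [u]; rewrite /= in_itv /= => /andP[u0 u1] <-.
exists (1 - u); first by rewrite /= in_itv /= subr_ge0 u1 gerBl.
by rewrite subKr addrC.
Qed.

Lemma chord_side s t z : chord s t z -> side s t z = 0.
Proof. by case=> u _ <-; rewrite side_affine !side_pt !subrr !(mulr0, mul0r) addr0. Qed.

Lemma chord_pt s t u : chord s t (circle_pt u) -> u = s \/ u = t.
Proof.
move/chord_side/eqP; rewrite side_pt !mulf_eq0 invr_eq0 (negbTE (denom_neq0 _)) orbF.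
by rewrite !subr_eq0 => /orP[] /eqP; [left|right].
Qed.

(** Both ends of the second chord, hence all of it, lie strictly on one side of
the line through s and t. *)
Lemma chords_apart s t s' t' z :
    0 < (s' - s) * (s' - t) * ((t' - s) * (t' - t)) ->
  chord s t z -> chord s' t' z -> False.
Proof.
move=> pos /chord_side z0 [u]; rewrite /= in_itv /= => /andP[u0 u1] uz.
move: z0; rewrite -uz side_affine !side_pt.
set x := _ / _; set y := _ / _ => xy.
have xy0 : 0 < x * y.
  by rewrite /x /y mulrACA -invfM divr_gt0 // mulr_gt0 ?denom_gt0.
have u1' : 0 <= 1 - u by rewrite subr_ge0.
have : (1 - u) * x ^+ 2 + u * (x * y) = 0.
  have -> : (1 - u) * x ^+ 2 + u * (x * y) = x * ((1 - u) * x + u * y) by ring.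
  by rewrite xy mulr0.
have h1 : 0 <= (1 - u) * x ^+ 2 by rewrite mulr_ge0 // sqr_ge0.
have h2 : 0 <= u * (x * y) by rewrite mulr_ge0 // ltW.
move/eqP; rewrite paddr_eq0 //.
have x0 : x != 0 by apply: contraTneq xy0 => ->; rewrite mul0r ltxx.
case/andP; rewrite mulf_eq0 subr_eq0 expf_eq0 (negbTE x0) andbF orbF => /eqP <-.
by rewrite mul1r (gt_eqF xy0).
Qed.

Lemma chords_sharing s t t' z : t' != s -> t' != t ->
  chord s t z -> chord s t' z -> z = circle_pt s.
Proof.
move=> ts tt /chord_side z0 [u _ uz].
move: z0; rewrite -uz side_affine !side_pt subrr !mul0r mulr0 add0r => /eqP.
rewrite !mulf_eq0 invr_eq0 (negbTE (denom_neq0 _)) orbF !subr_eq0.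
rewrite (negbTE ts) (negbTE tt) !orbF => /eqP ->.
by rewrite subr0 scale1r scale0r addr0.
Qed.

(** In suitable homogeneous coordinates the point of parameter x is (1, x, x^2),
with weight 1 + x^2. Four points of this conic satisfy one linear relation, whose coefficients are
the Vandermonde products of the other three, with alternating signs. Moving the
negative terms to the other side exhibits a common point of the chords. *)
Lemma chords_cross s t s' t' : s < s' -> s' < t -> t < t' ->
  (chord s t `&` chord s' t') !=set0.
Proof.
pose V (x y z : R) : R := (y - x) * (z - x) * (z - y).
have V0 (x y z : R) : x < y -> y < z -> 0 < V x y z.
  move=> xy yz; rewrite !mulr_gt0 ?subr_gt0 //; exact: lt_trans xy yz.
move=> ss st tt.
have st' := lt_trans ss st; have st2 := lt_trans st tt; have st3 := lt_trans ss st2.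
pose wa := V s' t t' * (1 + s ^+ 2); pose wb := V s s' t' * (1 + t ^+ 2).
pose ws := V s t t' * (1 + s' ^+ 2); pose wt := V s s' t * (1 + t' ^+ 2).
have wa0 : 0 < wa by rewrite mulr_gt0 ?V0 ?denom_gt0.
have wb0 : 0 < wb by rewrite mulr_gt0 ?V0 ?denom_gt0.
have ws0 : 0 < ws by rewrite mulr_gt0 ?V0 ?denom_gt0.
have wt0 : 0 < wt by rewrite mulr_gt0 ?V0 ?denom_gt0.
have ab : wa + wb = ws + wt by rewrite /wa /wb /ws /wt /V; ring.
have bary p q (x y : R) : 0 < p -> 0 < q ->
    segment (circle_pt x) (circle_pt y)
      ((p * (circle_pt x).1 + q * (circle_pt y).1) / (p + q),
       (p * (circle_pt x).2 + q * (circle_pt y).2) / (p + q)).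
  move=> p0 q0; have pq : 0 < p + q by rewrite addr_gt0.
  exists (q / (p + q)).
    rewrite /= in_itv /= divr_ge0 ?(ltW pq) ?(ltW q0) //= ler_pdivrMr // mul1r.
    by rewrite lerDr ltW.
  rewrite segment_coords; have pqn : p + q != 0 by rewrite gt_eqF.
  by congr (_, _); field; exact: pqn.
exists ((wa * (circle_pt s).1 + wb * (circle_pt t).1) / (wa + wb),
        (wa * (circle_pt s).2 + wb * (circle_pt t).2) / (wa + wb)).
split; first exact: bary.
rewrite ab (_ : wa * _ + _ = ws * (circle_pt s').1 + wt * (circle_pt t').1).
  rewrite (_ : wa * _ + _ = ws * (circle_pt s').2 + wt * (circle_pt t').2).
    exact: bary.
all: have := (denom_neq0 s, denom_neq0 t, denom_neq0 s', denom_neq0 t').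
all: case=> [] [[]] d1 d2 d3 d4; rewrite /wa /wb /ws /wt /V /=.
all: field; rewrite ?d1 ?d2 ?d3 ?d4 //.
Qed.

Definition interleaved (p q : nat * nat) : bool :=
  (p.1 < q.1 < p.2)%N && (p.2 < q.2)%N || (q.1 < p.1 < q.2)%N && (q.2 < p.2)%N.

Definition nat_chord (p : nat * nat) := chord p.1%:R p.2%:R.

Lemma nat_chords_meet p q : (p.1 < p.2)%N -> (q.1 < q.2)%N ->
    p.1 != q.1 -> p.1 != q.2 -> p.2 != q.1 -> p.2 != q.2 ->
  (nat_chord p `&` nat_chord q) !=set0 <-> interleaved p q.
Proof.
case: p q => [a b] [c d] /= ab cd nac nad nbc nbd; split; last first.
  case/orP=> /= /andP[/andP[h1 h2] h3]; first by apply: chords_cross; rewrite ltr_nat.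
  by rewrite setIC; apply: chords_cross; rewrite ltr_nat.
case=> z [z1 z2]; apply: contrapT => nint.
apply: (@chords_apart _ _ _ _ z _ z1 z2) => /=.
have out (n : nat) : (n < a)%N || (b < n)%N -> 0 < (n%:R - a%:R) * (n%:R - b%:R) :> R.
  case/orP=> h.
    by rewrite nmulr_rgt0 subr_lt0 ltr_nat // (ltn_trans h).
  by rewrite mulr_gt0 // subr_gt0 ltr_nat // (ltn_trans ab).
have ins (n : nat) : (a < n < b)%N -> (n%:R - a%:R) * (n%:R - b%:R) < 0 :> R.
  by case/andP=> h h'; rewrite pmulr_rlt0 ?subr_gt0 ?subr_lt0 ltr_nat.
have [ci|co] := boolP (a < c < b)%N.
  rewrite nmulr_rgt0; last exact: ins.
  by apply: ins; move: nint ci; rewrite /interleaved /=; lia.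
by apply: mulr_gt0; apply: out; move: nint co; rewrite /interleaved /=; lia.
Qed.

End Chords.

(** * A chord model on integer endpoints *)

Section Layout.
Variables (G : sgraph) (pos : G -> nat) (op : one_page pos).

Definition sorted_ends (g : edge G -> G * G) := forall e : edge G,
  [/\ adj (g e).1 (g e).2, val e = [set (g e).1; (g e).2]%SET &
      (pos (g e).1 < pos (g e).2)%N].

Lemma sorted_ends_exist : exists g, sorted_ends g.
Proof.
suff /choice[g gP] : forall e : edge G, exists uv : G * G,
  [/\ adj uv.1 uv.2, val e = [set uv.1; uv.2]%SET & (pos uv.1 < pos uv.2)%N].
  by exists g.
move=> e; have [u [v [uv eE]]] := edge_endsP e.
case: (ltngtP (pos u) (pos v)) => uvp.
- by exists (u, v).
- by exists (v, u); split=> //=; [rewrite adj_sym|rewrite eE finset.setUC].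
- by have := adj_neq uv; rewrite (op.1 _ _ uvp) eqxx.
Qed.

(** The modulus of the cyclic order of the positions. *)
Let M := (\max_(v : G) pos v).+1.

Let pos_lt v : (pos v < M)%N.
Proof. by rewrite ltnS; exact: leq_bigmax. Qed.

(** The end at u of the edge uv. Vertex u owns the interval of length M that starts
at 2M(pos u), and the edges at u end in it at distance (pos u - pos v) mod M
from its left end. Thus, going around the circle from u, neighbours that come
first are served last; this nests the edges at u instead of crossing them. *)
Definition slot u v := (2 * M * pos u +
  (if pos v < pos u then pos u - pos v else pos u + M - pos v))%N.

Definition span (g : edge G -> G * G) (x : subdivision1 G) : nat * nat :=
  match x with
  | inl v => (2 * M * pos v, 2 * M * pos v + M)
  | inr e => (slot (g e).1 (g e).2, slot (g e).2 (g e).1)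
  end%N.

Let base u v :
  (pos u < pos v)%N /\ (2 * M * pos u + 2 * M <= 2 * M * pos v)%N \/
  pos u = pos v /\ (2 * M * pos u = 2 * M * pos v)%N \/
  (pos v < pos u)%N /\ (2 * M * pos v + 2 * M <= 2 * M * pos u)%N.
Proof.
case: (ltngtP (pos u) (pos v)) => h; [left|right; right|right; left].
- by split=> //; rewrite -mulnSr leq_mul.
- by split=> //; rewrite -mulnSr leq_mul.
- by rewrite h.
Qed.

Let slot_range u v : pos u != pos v ->
  (2 * M * pos u < slot u v < 2 * M * pos u + M)%N.
Proof.
move=> uv; rewrite /slot; have := pos_lt u; have := pos_lt v.
by case: ifP => h; lia.
Qed.

Lemma span_lt g x : sorted_ends g -> ((span g x).1 < (span g x).2)%N.
Proof.
move=> gP; case: x => [v|e] /=; first by rewrite -[X in (X < _)%N]addn0 ltn_add2l.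
have := @slot_range (g e).1 (g e).2; have := @slot_range (g e).2 (g e).1.
by have := base (g e).1 (g e).2; have [_ _ lt] := gP e; lia.
Qed.

(** Two edges can interleave only if their vertices do, up to ties. A tie means a
common vertex, where the order of the slots decides, and without ties
[one_page] applies. *)
Lemma span_interleaved g (x y : subdivision1 G) :
    sorted_ends g -> x != y ->
  [&& (span g x).1 != (span g y).1, (span g x).1 != (span g y).2,
      (span g x).2 != (span g y).1 & (span g x).2 != (span g y).2] /\
  interleaved (span g x) (span g y) = adj x y.
Proof.
move=> gP; have pe v w : (v == w) = (pos v == pos w) by rewrite (inj_eq op.1).
have mix (v : G) (e : edge G) :
    [&& (span g (inl v)).1 != (span g (inr e)).1, (span g (inl v)).1 != (span g (inr e)).2,
      (span g (inl v)).2 != (span g (inr e)).1 & (span g (inl v)).2 != (span g (inr e)).2] /\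
    interleaved (span g (inl v)) (span g (inr e)) = (v \in val e).
  have [uv -> lt] := gP e; rewrite !inE !pe /interleaved /=.
  have := @slot_range (g e).1 (g e).2; have := @slot_range (g e).2 (g e).1.
  have := base (g e).1 (g e).2; have := base v (g e).1; have := base v (g e).2.
  by lia.
have intC p q : interleaved p q = interleaved q p by rewrite /interleaved orbC.
case: x y => [u|e] [v|f] xy.
- have uv : pos u != pos v by apply: contraNneq xy => /op.1 ->.
  have -> : adj (inl u : subdivision1 G) (inl v) = false by [].
  by rewrite /interleaved /=; have := base u v; lia.
- exact: mix.
- have [m1 m2] := mix v e; rewrite intC m2; split=> //.
  by move: m1 => /and4P[h1 h2 h3 h4]; rewrite eq_sym h1 eq_sym h3 eq_sym h2 eq_sym h4.
- have -> : adj (inr e : subdivision1 G) (inr f) = false by [].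
  have [uv eE lt] := gP e; have [uv' fE lt'] := gP f.
  have nef : (pos (g e).1 != pos (g f).1) || (pos (g e).2 != pos (g f).2).
    apply: contraNT xy; rewrite negb_or !negbK => /andP[/eqP/op.1 h1 /eqP/op.1 h2].
    by apply/eqP; congr inr; apply: val_inj; rewrite eE fE h1 h2.
  have nc1 := op.2 _ _ _ _ uv uv'; have nc2 := op.2 _ _ _ _ uv' uv.
  have l1 := pos_lt (g e).1; have l2 := pos_lt (g e).2.
  have l3 := pos_lt (g f).1; have l4 := pos_lt (g f).2.
  have b1 := base (g e).1 (g e).2; have b2 := base (g f).1 (g f).2.
  have b3 := base (g e).1 (g f).1; have b4 := base (g e).1 (g f).2.
  have b5 := base (g e).2 (g f).1; have b6 := base (g e).2 (g f).2.
  have n1 : (pos (g e).2 < pos (g e).1)%N = false by rewrite ltnNge (ltnW lt).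
  have n2 : (pos (g f).2 < pos (g f).1)%N = false by rewrite ltnNge (ltnW lt').
  rewrite /interleaved /= /slot n1 n2 lt lt'; clear n1 n2.
  move: b1 b2 b3 b4 b5 b6 l1 l2 l3 l4 nc1 nc2 nef lt lt'; clear.
  move: (pos (g e).1) (pos (g e).2) (pos (g f).1) (pos (g f).2) => a b c d.
  move: (2 * M * a)%N (2 * M * b)%N (2 * M * c)%N (2 * M * d)%N => A B C D.
  move=> b1 b2 b3 b4 b5 b6 l1 l2 l3 l4 nc1 nc2 nef lt lt'.
  have {b1} b1 : (A + 2 * M <= B)%N by lia.
  have {b2} b2 : (C + 2 * M <= D)%N by lia.
  (* Fixing the relative order of the four ends makes the rest linear. *)
  case: b3 => [[h3 k3]|[[h3 k3]|[h3 k3]]]; case: b6 => [[h6 k6]|[[h6 k6]|[h6 k6]]];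
    case: b4 => [[h4 k4]|[[h4 k4]|[h4 k4]]]; try (exfalso; lia);
    case: b5 => [[h5 k5]|[[h5 k5]|[h5 k5]]]; try (exfalso; lia).
  all: try (exfalso; clear k3 k4 k5 k6 b1 b2; lia).
  all: clear nc1 nc2 nef.
  all: (split; [apply/and4P; split; lia|apply/negbTE; rewrite negb_or; apply/andP; split; lia]).
Qed.

End Layout.

(** * Models built from a vertex numbering *)

Section Models.
Variables (R : realType) (G : sgraph) (pos : G -> nat) (op : one_page pos).

Lemma one_page_circle_graph : circle_graph R (subdivision1 G).
Proof.
have [g gP] := sorted_ends_exist op.
pose phi x := @nat_chord R (span pos g x).
have lt x := span_lt x gP.
have meet x y : x != y -> (phi x `&` phi y) !=set0 <-> adj x y.
  move=> xy; have [/and4P[n1 n2 n3 n4] <-] := span_interleaved op gP xy.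
  by apply: nat_chords_meet.
have phi_inj x y : phi x = phi y -> x = y.
  move=> e; apply/eqP; apply: contraT => xy.
  have [/and4P[n1 n2 _ _] _] := span_interleaved op gP xy.
  have : phi y (circle_pt (span pos g x).1%:R) by rewrite -e; exact: segmentl.
  by case/chord_pt => /eqP; rewrite eqr_nat ?(negbTE n1) ?(negbTE n2).
exists (0, 0), 1; split=> //; exists (range phi); split.
  move=> _ [x _ <-]; exists (circle_pt (span pos g x).1%:R), (circle_pt (span pos g x).2%:R).
  split=> //; try exact: circle_ptP.
  by move/circle_pt_inj/eqP; rewrite eqr_nat ltn_eqF.
exists phi; split.
  split; [by move=> x _; exists x|by move=> x y _ _ /phi_inj|].
  by move=> _ [x _ <-]; exists x.
move=> x y; split=> [xy|[nxy mxy]].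
  have nxy : x != y by apply: contraTneq xy => ->; rewrite adj_irrefl.
  by split; [move/phi_inj/eqP; rewrite (negbTE nxy)|apply/meet].
by apply/meet => //; apply: contra_notN nxy => /eqP ->.
Qed.

Lemma segment_arc (a b : R * R) : a <> b -> is_arc a b (segment a b).
Proof.
move=> ab; exists (fun t => (1 - t) *: a + t *: b); split=> //.
- exact/continuous_subspaceT/segment_continuous.
- move=> s t _ _ e; apply/eqP; rewrite -subr_eq0.
  have : (s - t) *: (b - a) = 0.
    have -> : (s - t) *: (b - a) = ((1 - s) *: a + s *: b) - ((1 - t) *: a + t *: b).
      by case: a b {ab e} => [? ?] [? ?]; congr (_, _); do 2!rewrite /GRing.scale /=; ring.
    by rewrite e subrr.
  by move/eqP; rewrite scaler_eq0 subr_eq0 => /orP[|/eqP/subr0_eq/esym].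
- by rewrite subr0 scale1r scale0r addr0.
- by rewrite subrr scale1r scale0r add0r.
Qed.

(** The outer face is the component of (2, 0): it contains the circle of radius 2
and every radial segment from that circle towards a vertex. *)
Lemma one_page_outerplanar : outerplanar R G.
Proof.
have [g gP] := sorted_ends_exist op.
pose p v : R * R := circle_pt (pos v)%:R.
pose gam e := segment (p (g e).1) (p (g e).2).
have p_inj : injective p.
  by move=> u v /circle_pt_inj /eqP; rewrite eqr_nat => /eqP/op.1.
have p_eq u v : ((pos u)%:R == (pos v)%:R :> R) = (u == v).
  by rewrite eqr_nat (inj_eq op.1).
have in_disk z : drawing p gam z -> disk (0, 0) 1 z.
  have pd v : disk (0, 0) 1 (p v) by rewrite /disk /= (@circle_ptP R (pos v)%:R).
  by case=> [[v _ <-]|[e _ ez]]; [exact: pd|exact: disk_convex ez].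
have ve (e : edge G) v : (v \in val e) = (v == (g e).1) || (v == (g e).2).
  by have [_ -> _] := gP e; rewrite !inE.
exists p, gam; split.
  split=> //.
  - move=> e u v uv uE vE; have [_ _ lt] := gP e.
    have pn : p (g e).1 <> p (g e).2.
      by move/p_inj => h; rewrite h ltnn in lt.
    move: uE vE uv; rewrite !ve => /orP[] /eqP -> /orP[] /eqP ->; rewrite ?eqxx // => _.
      exact: segment_arc.
    rewrite /gam /p -/(chord _ _) chordC.
    by apply: segment_arc => /p_inj h; rewrite h ltnn in lt.
  - move=> e w /chord_pt; rewrite ve -!p_eq.
    by case=> ->; rewrite eqxx ?orbT.
  - move=> e f ef z [ez fz].
    have [uve eE lte] := gP e; have [uvf fE ltf] := gP f.
    have share u v w : v != w -> v != u -> w != u -> chord (pos u)%:R (pos v)%:R z ->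
        chord (pos u)%:R (pos w)%:R z -> range p z.
      move=> vw vu wu zv zw; exists u => //; apply/esym.
      by apply: (chords_sharing _ _ zv zw); rewrite p_eq // eq_sym.
    have other (h : edge G) u : u \in val h -> exists v,
        [/\ v != u, gam h = chord (pos u)%:R (pos v)%:R & val h = [set u; v]%SET].
      have [/adj_neq uv hE _] := gP h; rewrite ve => /orP[] /eqP ->.
        by exists (g h).2; rewrite eq_sym uv.
      by exists (g h).1; rewrite chordC finset.setUC.
    have [[u [ue uf]]|nuf] := pselect (exists u, u \in val e /\ u \in val f).
      have [v [vu gv ev]] := other e u ue; have [w [wu gw fw]] := other f u uf.
      have vw : v != w by apply: contraNneq ef => vw; apply/eqP/val_inj; rewrite ev fw vw.
      by apply: (share u v w) => //; rewrite -?gv -?gw.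
    have n u v : u \in val e -> v \in val f -> u != v.
      by move=> ue vf; apply: contra_notN nuf => /eqP uv; exists u; rewrite {2}uv.
    have e1 : (g e).1 \in val e by rewrite ve eqxx.
    have e2 : (g e).2 \in val e by rewrite ve eqxx orbT.
    have f1 : (g f).1 \in val f by rewrite ve eqxx.
    have f2 : (g f).2 \in val f by rewrite ve eqxx orbT.
    have : (@nat_chord R (pos (g e).1, pos (g e).2) `&`
            @nat_chord R (pos (g f).1, pos (g f).2)) !=set0 by exists z.
    rewrite nat_chords_meet //= ?(inj_eq op.1) ?n //.
    case/orP=> /= /andP[/andP[l1 l2] l3].
      by case: (op.2 _ _ _ _ uve uvf).
    by case: (op.2 _ _ _ _ uvf uve).
have outside v : exists S : set (R * R), [/\ connected S, S (2, 0),
    S `<=` ~` drawing p gam & closure S (p v)].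
  (* The radius through p v: far 0 is p v, far 1 is on the circle of radius 2. *)
  pose far t := ((1 + t) * (p v).1, (1 + t) * (p v).2).
  have farE t : sqdist (far t) (0, 0) = (1 + t) ^+ 2.
    have : circle (0, 0) 1 (p v) := circle_ptP _.
    rewrite /circle /sqdist /far /= !subr0 !exprMn -mulrDr => ->.
    by rewrite expr1n mulr1.
  exists (circle (0, 0) 2 `|` far @` `]0, 1]); split.
  - apply: connectedU; [|apply: circle_connected; exact: ler0n|].
      exists (far 1); split; first by rewrite /circle /= farE.
      by exists 1 => //=; rewrite in_itv /= ltr01 lexx.
    apply: connected_continuous_connected.
      by apply/connected_intervalP; exact: interval_is_interval.
    apply/continuous_subspaceT/continuous_coords => t; apply: cvgM; try exact: cvg_cst.
      by apply: cvgD; [exact: cvg_cst|exact: cvg_id].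
    by apply: cvgD; [exact: cvg_cst|exact: cvg_id].
  - by left; rewrite /circle /sqdist /= !subr0; ring.
  - move=> z [|[t]] /=.
      rewrite /circle /= => zc /in_disk; rewrite /disk /= zc.
      by rewrite expr1n expr2; lra.
    rewrite in_itv /= => /andP[t0 _] <- /in_disk; rewrite /disk /= farE expr1n.
    by move=> h; nra.
  - move=> B /nbhs_ballP[e /= e0 eB].
    pose t : R := Num.min 1 (e / 2).
    have t0 : 0 < t by rewrite lt_min ltr01 divr_gt0.
    have te : t < e by rewrite gt_min [X in _ || X](_ : _ = true) ?orbT //; lra.
    have t1 : t <= 1 by rewrite ge_min lexx.
    exists (far t); split; first by right; exists t => //=; rewrite in_itv /= t0.
    apply: eB; rewrite -ball_normE; change (`|p v - far t| < e).
    have : circle (0, 0) 1 (p v) := circle_ptP _.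
    rewrite /far; case: (p v) => x y; rewrite /circle /sqdist /= !subr0 expr1n => xy.
    rewrite /Num.norm /= gt_max.
    have small (w : R) : w ^+ 2 <= 1 -> `|w - (1 + t) * w| < e.
      move=> w1; rewrite (_ : w - _ = - (t * w)); last by ring.
      rewrite normrN normrM gtr0_norm //; apply: le_lt_trans te.
      by rewrite ler_piMr ?(ltW t0) // -(@ler_pXn2r _ 2) ?nnegrE // real_normK ?num_real // expr1n.
    by apply/andP; split; apply: small; rewrite -xy ?lerDl ?lerDr sqr_ge0.
exists (connected_component (~` drawing p gam) (2, 0)); split.
  exists (2, 0) => // /in_disk; rewrite /disk /sqdist /= !subr0 => h.
  by move: h; lra.
move=> v; have [S [kS S0 SD Sv]] := outside v.
by apply: closureS Sv; exact: connected_component_max.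
Qed.
End Models.

Theorem lemma1 (R : realType) (G : sgraph) :
  let H := subdivision1 G in
  [<-> circle_graph R H;
       outer_segment_graph R H;
       outer_string_graph R H;
       outerplanar R G].
Proof.
move=> H; tfae.
- move=> [c [r [r0 [F [Fc FH]]]]]; exists c, r; split=> //; exists F; split=> //.
  exact: subset_trans Fc (@chord_outer_segment _ _ _).
- move=> [c [r [r0 [F [Fs FH]]]]]; exists c, r; split=> //; exists F; split=> //.
  exact: subset_trans Fs (@outer_segment_string _ _ _).
- by move/outer_string_one_page => [pos op]; exact: one_page_outerplanar op.
- by move/outerplanar_one_page => [pos op]; exact: one_page_circle_graph op.
Qed.
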